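(* Let $G$ be a finite regular partial cube that is not isomorphic to $K_1$ or $K_2$, and let $n\geqslant 4$ be an integer. Then every convex cycle of $G$ is a $2n$-cycle if and only if $G$ is isomorphic to the cycle $C_{2n}$.
   Context: All graphs are finite, simple and undirected. A subgraph $H$ of $G$ is isometric if $d_H(u,v)=d_G(u,v)$ for all $u,v\in V(H)$, and convex if moreover every shortest $u,v$-path in $G$ (for $u,v\in V(H)$) lies in $H$. A partial cube is a graph isomorphic to an isometric subgraph of some hypercube $Q_n$. A convex cycle is a cycle that is a convex subgraph; an $l$-cycle is a cycle with $l$ edges. *)

(* Defs.v *)
From mathcomp Require Import all_boot.
Set Implicit Arguments. Unset Strict Implicit. Unset Printing Implicit Defensive.

Section Graphs.
Variable T : finType.

Definition simple_graph (e : rel T) : Prop :=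
  symmetric e /\ irreflexive e.

Definition walk (e : rel T) (u v : T) (k : nat) : Prop :=
  exists p : seq T, [/\ size p = k, path e u p & last u p = v].

Definition dist_is (e : rel T) (u v : T) (k : nat) : Prop :=
  walk e u v k /\ forall j, j < k -> ~ walk e u v j.

Definition shortest_path (e : rel T) (u v : T) (p : seq T) : Prop :=
  [/\ path e u p, last u p = v & dist_is e u v (size p)].

Definition isometric (e : rel T) (VH : {set T}) (eH : rel T) : Prop :=
  forall u v, u \in VH -> v \in VH ->
    forall k, dist_is eH u v k <-> dist_is e u v k.

Definition convex (e : rel T) (VH : {set T}) (eH : rel T) : Prop :=
  isometric e VH eH /\
  forall u v, u \in VH -> v \in VH ->
    forall p, shortest_path e u v p -> all (mem VH) p /\ path eH u p.

Definition is_cycle (e : rel T) (c : seq T) : Prop :=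
  [/\ uniq c, 3 <= size c & cycle e c].

Definition cycle_rel (c : seq T) : rel T :=
  fun x y => (x \in c) && (y \in c) && ((y == next c x) || (x == next c y)).

Definition convex_cycle (e : rel T) (c : seq T) : Prop :=
  is_cycle e c /\ convex e [set x in c] (cycle_rel c).

Definition regular (e : rel T) : Prop :=
  exists k, forall v, #|[set w | e v w]| = k.

End Graphs.

Definition hypercube_rel (m : nat) : rel {ffun 'I_m -> bool} :=
  fun a b => #|[set i | a i != b i]| == 1.

(* G is isomorphic to an isometric subgraph of some hypercube Q_m:
   an injective edge-preserving map f (G is isomorphic to its image subgraph H
   whose edges are the images of the edges of G) such that
   d_G(u,v) = d_H(f u, f v) = d_{Q_m}(f u, f v). *)
Definition partial_cube (T : finType) (e : rel T) : Prop :=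
  exists m (f : T -> {ffun 'I_m -> bool}),
    [/\ injective f,
        (forall u v, e u v -> hypercube_rel (f u) (f v)) &
        (forall u v k, dist_is e u v k <-> dist_is (@hypercube_rel m) (f u) (f v) k)].

Definition isomorphic (T T' : finType) (e : rel T) (e' : rel T') : Prop :=
  exists f : T -> T', bijective f /\ forall x y, e' (f x) (f y) = e x y.

Definition complete_graph (n : nat) : rel 'I_n := fun i j => i != j.

Definition cycle_graph (m : nat) : rel 'I_m :=
  fun i j => (nat_of_ord j == i.+1 %% m) || (nat_of_ord i == j.+1 %% m).

Arguments complete_graph n : clear implicits.
Arguments cycle_graph m : clear implicits.

(* Main.v *)
(**
Embed G isometrically in a hypercube: vertices are 0/1 vectors and each edge flips one coordinate,
its class.  Two edges of a class i bound a "ladder" between the two sides of i.  A ladder that no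
third edge of class i splits is a convex cycle; hence, when all convex cycles have length 2n, two
distinct edges of a class are at distance at least n - 1, and at distance n - 1 they are opposite
edges of a convex cycle.  For n >= 4 this rigidity forces two convex cycles through a common edge
to share neither a second edge nor a second class.  So the edges of a class, joined when they are
opposite on a convex cycle, form a forest whose paths are geodesics of G, and therefore any two
edges at z leading towards a span a convex cycle that descends towards a.

Now take an inclusion-minimal side W of a class f, and two ends a, c in W of edges of class f at
maximal distance.  If all degrees are at least 3, then c has a neighbour, not across f, that is
farther from a.  By minimality of W this neighbour lies on a convex cycle through the f-edge at c,
whose second f-edge has an end in W farther from a than c: a contradiction.  In degree 2, a convex
cycle obtained in the same way must be the whole graph.
*)

(* A convex 2n-cycle crosses n classes, each twice, so its opposite edges are at distance [N] = n -
   1, the constant used throughout. The condition [2 < N] enters, for example, where two edges of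
   one class at distance 2 have to coincide.

   The ladder criterion is stated for an abstract predicate [bad] because it is applied to several
   families: ladders of least length, ladders of length exactly [N], shortest ladders below a bound
   whose length is not [N], and shortest ladders whose ends are not joined by a chain of convex
   cycles. In each family a third edge that splits a bad ladder leaves a bad half. So a bad ladder
   spans a convex cycle, and the hypothesis on convex cycles fixes its length to [N].

   The main obstacle is a circularity. That chains of convex cycles are geodesics is proved from
   descending cycles, and descending cycles are found as first links of such chains. It is broken by
   induction on the vertex set: a chain along a class i stays on one side of i, which is a smaller
   partial cube with the same convex cycle length. *)
Require Import Defs.
From mathcomp Require Import all_boot.
From mathcomp Require Import zify.
Set Implicit Arguments. Unset Strict Implicit. Unset Printing Implicit Defensive.

(* [lia] case-splits on every boolean hypothesis, so only arithmetic ones are kept *)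
Ltac alia := repeat match goal with H : ?P |- _ =>
  lazymatch P with
  | is_true (leq _ _) => fail
  | @eq ?T _ _ => tryif unify T nat then fail else clear H
  | _ => clear H
  end end; repeat match goal with
  | H : context [Equality.sort (fintype_Finite__to__eqtype_Equality ?J)] |- _ =>
      change (Equality.sort (fintype_Finite__to__eqtype_Equality J)) with (Finite.sort J) in H
  | |- context [Equality.sort (fintype_Finite__to__eqtype_Equality ?J)] =>
      change (Equality.sort (fintype_Finite__to__eqtype_Equality J)) with (Finite.sort J)
  end; lia.

(** * Hypercube geometry: distance, betweenness, geodesics and closed walks *)

Section Cube.
Variable I : finType.
Notation cube := {ffun I -> bool}.
Implicit Types (x y z u v w : cube) (s t : seq I) (i k : I) (j : nat) (V : {set cube}).

(* Repeated entries of s count only once *)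
Definition flip x s : cube := [ffun i => x i (+) (i \in s)].
Definition step x i : cube := [ffun k => x k (+) (k == i)].
Definition dif x y : {set I} := [set i | x i != y i].
Definition ham x y : nat := #|dif x y|.
Definition btw x z y : Prop := forall i, x i = y i -> z i = x i.

Lemma flipE x s i : flip x s i = x i (+) (i \in s).
Proof. by rewrite ffunE. Qed.

Lemma stepE x i k : step x i k = x k (+) (k == i).
Proof. by rewrite ffunE. Qed.

Lemma flip1 x i : flip x [:: i] = step x i.
Proof. by apply/ffunP => k; rewrite flipE stepE inE. Qed.

Lemma stepK x i : step (step x i) i = x.
Proof. by apply/ffunP => k; rewrite !stepE -addbA addbb addbF. Qed.

Lemma flip0 x : flip x [::] = x.
Proof. by apply/ffunP => i; rewrite flipE addbF. Qed.

Lemma flipK x s : flip (flip x s) s = x.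
Proof. by apply/ffunP => i; rewrite !flipE -addbA addbb addbF. Qed.

Lemma flipC x s t : flip (flip x s) t = flip (flip x t) s.
Proof. by apply/ffunP => i; rewrite !flipE addbAC. Qed.

Lemma flip_eqi x s t : s =i t -> flip x s = flip x t.
Proof. by move=> st; apply/ffunP => i; rewrite !flipE st. Qed.

Lemma flip_cat x s t : uniq (s ++ t) -> flip x (s ++ t) = flip (flip x s) t.
Proof.
rewrite cat_uniq => /and3P[_ /hasPn st _]; apply/ffunP => i; rewrite !flipE mem_cat.
by case it: (i \in t); rewrite ?orbF ?addbF // (negbTE (st _ it)) addbF.
Qed.

Lemma flip_mem x s t : flip x s = flip x t -> s =i t.
Proof. by move=> e i; move/ffunP/(_ i): e; rewrite !flipE => /addbI. Qed.

Lemma in_dif x y i : (i \in dif x y) = (x i != y i).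
Proof. by rewrite inE. Qed.

Lemma dif_flip x s : dif x (flip x s) =i s.
Proof. by move=> i; rewrite in_dif flipE; case: (x i); case: (i \in s). Qed.

Lemma ham_flip x s : uniq s -> ham x (flip x s) = size s.
Proof. by move=> us; rewrite /ham (eq_card (dif_flip x s)); apply/card_uniqP. Qed.

Lemma hamC x y : ham x y = ham y x.
Proof. by apply: eq_card => i; rewrite !in_dif eq_sym. Qed.

Lemma ham_flip2 x y s : ham (flip x s) (flip y s) = ham x y.
Proof.
apply: eq_card => i; rewrite !in_dif !flipE.
by case: (x i); case: (y i); case: (i \in s).
Qed.

Lemma ham_step x i : ham x (step x i) = 1.
Proof. by rewrite -flip1 ham_flip. Qed.

Lemma ham_step2 x y i : ham (step x i) (step y i) = ham x y.
Proof. by rewrite -!flip1 ham_flip2. Qed.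

Lemma ham_eq0 x y : (ham x y == 0) = (x == y).
Proof.
rewrite cards_eq0; apply/eqP/eqP => [d|->]; last by apply/setP => i; rewrite !inE eqxx.
by apply/ffunP => i; move/setP/(_ i): d; rewrite !inE => /negbFE/eqP.
Qed.

Lemma ham0 x : ham x x = 0.
Proof. by apply/eqP; rewrite ham_eq0. Qed.

Lemma ham_tri z x y : ham x y <= ham x z + ham z y.
Proof.
rewrite /ham -cardsUI; apply: leq_trans (leq_addr _ _); apply: subset_leq_card.
apply/subsetP => i; rewrite !inE.
by case: (x i); case: (y i); case: (z i).
Qed.

Lemma ham_btw x z y : btw x z y <-> ham x z + ham z y = ham x y.
Proof.
rewrite /ham -cardsUI; split=> [b|e].
  have -> : dif x z :&: dif z y = set0.
    apply/setP => i; rewrite !inE; have := b i.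
    by case: (x i); case: (y i); case: (z i) => // /(_ erefl).
  rewrite cards0 addn0; apply: eq_card => i; rewrite !inE; have := b i.
  by case: (x i); case: (y i); case: (z i) => // /(_ erefl).
have sub: dif x y \subset dif x z :|: dif z y.
  by apply/subsetP => i; rewrite !inE; case: (x i); case: (y i); case: (z i).
have := subset_leq_card sub; move=> le.
have /eqP: #|dif x z :&: dif z y| = 0 by alia.
rewrite cards_eq0 => /eqP/setP d i; move: (d i); rewrite !inE.
by case: (x i); case: (y i); case: (z i).
Qed.

Lemma btw_sym x z y : btw x z y -> btw y z x.
Proof. by move=> b i e; rewrite b // -e. Qed.

Lemma btw_dif x z y i : btw x z y -> x i != z i -> x i != y i.
Proof. by move=> b; apply: contra_neq => /b. Qed.

Lemma btw_trans x u z y : btw x u y -> btw x z u -> btw x z y.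
Proof. by move=> b1 b2 i e; rewrite b2 // b1. Qed.

Lemma btw_hull x y u v z : btw x u y -> btw x v y -> btw u z v -> btw x z y.
Proof. by move=> b1 b2 b i e; rewrite b ?b1 ?b2. Qed.

Lemma ham_flips x s t : uniq s -> uniq t ->
  ham (flip x s) (flip x t) + 2 * #|[set i in s | i \in t]| = size s + size t.
Proof.
move=> us ut.
have -> : size s + size t = #|[set i in s]| + #|[set i in t]|.
  by rewrite !cardsE (card_uniqP us) (card_uniqP ut).
rewrite -cardsUI; set A := [set i in s]; set B := [set i in t].
have -> : [set i in s | i \in t] = A :&: B by apply/setP => i; rewrite !inE.
rewrite -(cardsID (A :&: B) (A :|: B)) mulSn mul1n.
have -> : (A :|: B) :&: (A :&: B) = A :&: B.
  by apply/setP => i; rewrite !inE; case: (i \in s); case: (i \in t).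
suff -> : ham (flip x s) (flip x t) = #|(A :|: B) :\: (A :&: B)| by alia.
apply: eq_card => i; rewrite !inE !flipE.
by case: (x i); case: (i \in s); case: (i \in t).
Qed.

Lemma ham_flips_disj x s t : uniq (s ++ t) -> ham (flip x s) (flip x t) = size s + size t.
Proof.
rewrite cat_uniq => /and3P[us /hasPn d ut]; rewrite -(ham_flips x us ut).
suff -> : [set i in s | i \in t] = set0 by rewrite cards0; alia.
by apply/setP => i; rewrite !inE andbC; case it: (i \in t) => //=; rewrite (negbTE (d _ it)).
Qed.

Lemma ham_flips_common x s t i : uniq s -> uniq t -> i \in s -> i \in t ->
  ham (flip x s) (flip x t) + 2 <= size s + size t.
Proof.
move=> us ut si ti; rewrite -(ham_flips x us ut).
have : 0 < #|[set i in s | i \in t]| by apply/card_gt0P; exists i; rewrite inE si.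
alia.
Qed.

Lemma ham_flips_le x s t : uniq s -> uniq t -> ham (flip x s) (flip x t) <= size s + size t.
Proof. by move=> us ut; rewrite -(ham_flips x us ut) leq_addr. Qed.

(** The well-graded families of set theory: exactly the vertex sets of isometric subgraphs of the
    hypercube. Distance inside such a [V] is [ham]. *)
Definition well_graded V : Prop :=
  forall x y, x \in V -> y \in V -> x != y -> exists2 i, x i != y i & step x i \in V.

(** A path is stored as its start and the sequence of classes it crosses; distinct classes make it a
    geodesic. *)
Definition geo V x s : Prop := uniq s /\ forall j, flip x (take j s) \in V.

(* The closed walk that reads s twice; after reading s once, the vertices are the flips of x by
   the suffixes of s *)
Definition cyc V x s : Prop :=
  uniq s /\ forall j, flip x (take j s) \in V /\ flip x (drop j s) \in V.

Definition oncyc x s z : Prop :=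
  exists j, z = flip x (take j s) \/ z = flip x (drop j s).

(** A convex cycle with [2 * size s] vertices. The bound on [size s] excludes a single edge walked
    back and forth. *)
Definition ccyc V x s : Prop :=
  [/\ cyc V x s, 1 < size s &
      forall u v z, oncyc x s u -> oncyc x s v -> z \in V -> btw u z v -> oncyc x s z].

(** Two edges of class i, each given by its end on a common side of i; the distance between these
    edges is [ham x y]. *)
Definition mates V i x y : Prop :=
  [/\ x \in V, step x i \in V, y \in V, step y i \in V & x i = y i].

Lemma ham_flip1 x y i : x i != y i -> (ham (step x i) y).+1 = ham x y.
Proof.
move=> xy; rewrite /ham [in RHS](cardsD1 i) inE xy add1n; congr _.+1.
apply: eq_card => k; rewrite !inE stepE; case: (eqVneq k i) => [->|_]; rewrite ?addbF //=.
by move: xy; case: (x i); case: (y i).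
Qed.

Lemma geo0 V x : x \in V -> geo V x [::].
Proof. by move=> xV; split=> // j; rewrite flip0. Qed.

Lemma flip_cons x i s : i \notin s -> flip x (i :: s) = flip (step x i) s.
Proof.
move=> si; apply/ffunP => k; rewrite !flipE stepE inE; case: (eqVneq k i) => [->|_]; rewrite ?addbF //=.
by rewrite (negbTE si) addbF.
Qed.

Lemma geo_cons V x i s : x \in V -> i \notin s -> geo V (step x i) s -> geo V x (i :: s).
Proof.
move=> xV si [us g]; split=> [|[|j]] /=; rewrite ?si ?us ?flip0 //.
by rewrite flip_cons ?g //; apply: contra si => /mem_take.
Qed.

Lemma geo_ex V x y : well_graded V -> x \in V -> y \in V ->
  exists2 s, geo V x s & flip x s = y.
Proof.
move=> wg + yV; have [d] := ubnP (ham x y); elim: d x => // d IH x le xV.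
have [->|xy] := eqVneq x y; first by exists [::]; [apply: geo0 | rewrite flip0].
have [i xyi iV] := wg _ _ xV yV xy.
have [|s g e] := IH _ _ iV; first by have := ham_flip1 xyi; alia.
have si : i \notin s.
  move/ffunP/(_ i): e; rewrite flipE stepE eqxx; move: xyi.
  by case: (x i); case: (y i); case: (i \in s).
by exists (i :: s); [apply: geo_cons | rewrite flip_cons].
Qed.

Lemma geo_mem V x s : geo V x s -> x \in V.
Proof. by case=> _ /(_ 0); rewrite take0 flip0. Qed.

Lemma geo_end V x s : geo V x s -> flip x s \in V.
Proof. by case=> _ /(_ (size s)); rewrite take_size. Qed.

Lemma geo_cat V x s t : uniq (s ++ t) -> geo V x s -> geo V (flip x s) t -> geo V x (s ++ t).
Proof.
move=> u [us gs] [ut gt]; split=> // j; rewrite take_cat; case: ltnP => // le.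
rewrite flip_cat ?gt //; move: u; rewrite -{1}(cat_take_drop (j - size s) t) catA.
by rewrite cat_uniq => /and3P[].
Qed.

Lemma geo_btw V x y s t : geo V x s -> geo V (flip x s) t -> flip (flip x s) t = y ->
  btw x (flip x s) y -> geo V x (s ++ t) /\ flip x (s ++ t) = y.
Proof.
move=> gs gt e b; have u : uniq (s ++ t).
  rewrite cat_uniq (proj1 gs) (proj1 gt) andbT /=; apply/hasPn => i it /=.
  apply/negP => si; have := b i; rewrite -e !flipE it si.
  by case: (x i) => /(_ erefl).
by split; [apply: geo_cat | rewrite flip_cat].
Qed.

Lemma flip_take x s j : uniq s -> flip (flip x (take j s)) (drop j s) = flip x s.
Proof. by move=> us; rewrite -flip_cat cat_take_drop. Qed.

Lemma flip_drop x s j : uniq s -> flip (flip x s) (drop j s) = flip x (take j s).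
Proof. by move=> us; rewrite -(flip_take x j us) flipK. Qed.

Lemma flip_take2 x s j : uniq s -> flip (flip x s) (take j s) = flip x (drop j s).
Proof. by move=> us; rewrite -(flip_take x j us) flipC flipK. Qed.

Lemma geo_rev V x s : geo V x s -> geo V (flip x s) (rev s).
Proof.
case=> us g; split=> [|j]; first by rewrite rev_uniq.
rewrite take_rev (flip_eqi _ (mem_rev _)) flip_drop //.
Qed.

Lemma flip_rev x s : flip (flip x s) (rev s) = x.
Proof. by rewrite (flip_eqi _ (mem_rev s)) flipK. Qed.

Lemma geo_drop V x s j : geo V x s -> geo V (flip x (take j s)) (drop j s).
Proof.
case=> us g; split=> [|k]; first exact: drop_uniq.
have e : take j s ++ drop j (take (k + j) s) = take (k + j) s.
  by rewrite -{1}(@take_takel _ j (k + j) s) ?leq_addl // cat_take_drop.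
by rewrite take_drop -flip_cat e ?take_uniq.
Qed.

Lemma geo_take V x s j : geo V x s -> geo V x (take j s).
Proof.
case=> us g; split=> [|k]; first exact: take_uniq.
by case: (leqP k j) => kj; rewrite ?(take_takel _ kj) // (take_taker _ (ltnW kj)).
Qed.

Lemma cyc_geo V x s : cyc V x s -> geo V x s.
Proof. by case=> us c; split=> // j; have [] := c j. Qed.

Lemma cyc_rev V x s : cyc V x s -> cyc V x (rev s).
Proof.
case=> us c; split=> [|j]; first by rewrite rev_uniq.
rewrite take_rev drop_rev !(flip_eqi _ (mem_rev _)).
by split; [have [] := c (size s - j) | have [] := c (size s - j)].
Qed.

Lemma cyc_anti V x s : cyc V x s -> cyc V (flip x s) s.
Proof.
case=> us c; split=> // j; rewrite flip_take2 // flip_drop //.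
by have [] := c j.
Qed.

(** The new start is the vertex from which the closed walk reads [t] just before it returns to
    [x]. *)
Lemma cyc_rotr V x s t : cyc V x (s ++ t) -> cyc V (flip x t) (t ++ s).
Proof.
case=> us c.
have uts : uniq (t ++ s) by rewrite uniq_catC.
split=> // j; rewrite take_cat drop_cat; case: ltnP => le.
- have ut : uniq t by move: us; rewrite cat_uniq => /and3P[].
  have E : flip (flip x t) (take j t) = flip x (drop j t) by rewrite flip_take2.
  split.
    rewrite E; have [_] := c (size s + j); rewrite drop_cat; case: ltnP; [alia|].
    by rewrite addKn.
  have -> : flip (flip x t) (drop j t ++ s) = flip x (s ++ take j t).
    apply/ffunP => k; rewrite !flipE !mem_cat.
    have kt : (k \in t) = (k \in take j t) || (k \in drop j t).
      by rewrite -mem_cat cat_take_drop.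
    have d1 : k \in take j t -> k \notin drop j t.
      move=> h; move: ut; rewrite -{1}(cat_take_drop j t) cat_uniq => /and3P[_ /hasPn d _].
      by apply/negP => /d /=; rewrite h.
    have d2 : k \in t -> k \notin s.
      by move=> h; move: us; rewrite cat_uniq => /and3P[_ /hasPn d _]; apply: d.
    move: d1 d2; rewrite kt; case: (x k); case: (k \in take j t); case: (k \in drop j t);
      by case: (k \in s) => //=; try done; by [move=> /(_ isT) | move=> _ /(_ isT)].
  have [] := c (size s + j); rewrite take_cat; case: ltnP; [alia|].
  by rewrite addKn.
have us' : uniq s by move: us; rewrite cat_uniq => /and3P[].
set m := j - size t.
have -> : flip (flip x t) (t ++ take m s) = flip x (take m s).
  rewrite flip_cat ?flipK //; move: uts; rewrite -{1}(cat_take_drop m s) catA.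
  by rewrite cat_uniq => /and3P[].
have -> : flip (flip x t) (drop m s) = flip x (drop m s ++ t).
  rewrite flip_cat 1?flipC //; move: us; rewrite -{1}(cat_take_drop m s) -catA.
  by rewrite cat_uniq => /and3P[].
have [h|h] := ltnP m (size s); first by have := c m; rewrite take_cat drop_cat h.
have := c (size s); rewrite take_size_cat // drop_size_cat //.
by rewrite (take_oversize h) (drop_oversize h) cat0s.
Qed.

Lemma cyc_rot V x s t : cyc V x (s ++ t) -> cyc V (flip x s) (t ++ s).
Proof.
move=> c; have [u _] := c; have := cyc_rotr (cyc_anti c).
by rewrite flip_cat // flipK.
Qed.

Lemma cyc_drop V x s t : cyc V x (s ++ t) -> flip x t \in V.
Proof. by case=> _ /(_ (size s)) []; rewrite drop_size_cat. Qed.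

Lemma cyc_take V x s t : cyc V x (s ++ t) -> flip x s \in V.
Proof. by case=> _ /(_ (size s)) []; rewrite take_size_cat. Qed.

Lemma cyc_mem V x s : cyc V x s -> x \in V.
Proof. by move/cyc_geo/geo_mem. Qed.

Lemma matesC V i x y : mates V i x y -> mates V i y x.
Proof. by case=> *; split. Qed.

(** Some geodesic from [u] to [v] passes through [z], and it crosses class i exactly once, at the
    edge of [w]; so [z] lies before or after this edge. *)
Lemma cross V i u z v : well_graded V -> u \in V -> z \in V -> v \in V -> btw u z v -> u i != v i ->
  exists w, [/\ w \in V, step w i \in V, w i = u i,
    ham u w + 1 + ham (step w i) v = ham u v &
    (z i = u i -> btw u z w) /\ (z i = v i -> btw (step w i) z v)].
Proof.
move=> wg uV zV vV b uv.
have base : forall p q, p \in V -> q \in V -> p i != q i ->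
    exists w, [/\ w \in V, step w i \in V, w i = p i &
       ham p w + 1 + ham (step w i) q = ham p q].
  move=> p q pV qV; have [d] := ubnP (ham p q); elim: d p pV => // d IH p pV le pq.
  have pq' : p != q by apply: contra_neq pq => ->.
  have [k pk kV] := wg _ _ pV qV pq'; have hk := ham_flip1 pk.
  have [ki|ki] := eqVneq k i.
    move: kV hk; rewrite ki => kV hk; exists p; split=> [//|//|//|].
    by rewrite ham0; alia.
  have fi : step p k i = p i by rewrite stepE eq_sym (negbTE ki) addbF.
  have [||w [wV wiV wi e]] := IH _ kV; [alia | by rewrite fi |].
  exists w; split=> [//|//||]; first by rewrite wi.
  have h1 : ham p w <= (ham (step p k) w).+1.
    have := ham_tri (step p k) p w; rewrite ham_step; alia.
  have h2 := ham_tri w p q; have h3 := ham_tri (step w i) w q.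
  by rewrite ham_step in h3; alia.
(* The crossing is on the half of the geodesic whose ends differ at i: from [z] to [v] here, from
   [u] to [z] in the other case. *)
have [zi|zi] := eqVneq (z i) (u i).
  have zv : z i != v i by rewrite zi.
  have [w [wV wiV wi e]] := base _ _ zV vV zv.
  have h0 := proj1 (ham_btw _ _ _) b.
  have h1 := ham_tri z u w; have h2 := ham_tri w u v; have h3 := ham_tri (step w i) w v.
  rewrite ham_step in h3.
  exists w; split=> [//|//|||]; [by rewrite wi | alia |].
  split=> [_|]; first by apply/ham_btw; alia.
  by rewrite zi => e'; rewrite e' eqxx in uv.
have zv : z i = v i by move: zi uv; case: (z i); case: (u i); case: (v i).
have uz : u i != z i by rewrite eq_sym.
have [w [wV wiV wi e]] := base _ _ uV zV uz.
have h0 := proj1 (ham_btw _ _ _) b.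
have h1 := ham_tri z (step w i) v; have h2 := ham_tri (step w i) w v.
have h3 := ham_tri w u v.
rewrite ham_step in h2.
exists w; split=> [//|//|//||]; [alia|split=> [|_]]; first by move=> e'; rewrite e' eqxx in zi.
by apply/ham_btw; alia.
Qed.

End Cube.

(** * Unsplittable ladders are convex cycles *)

Section Ladder.
Variable I : finType.
Notation cube := {ffun I -> bool}.
Implicit Types (x y z u v w : cube) (s t : seq I) (i k : I) (j p q : nat).
Variables (V : {set cube}) (i : I) (D : nat) (bad : cube -> cube -> Prop).
(* [bad] selects ladders of length D; no third edge of class i splits a bad ladder into two
   ladders that are not bad *)
Hypotheses (wgV : well_graded V)
  (bad_mates : forall x y, bad x y -> mates V i x y)
  (bad_ham : forall x y, bad x y -> ham x y = D)
  (badC : forall x y, bad x y -> bad y x)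
  (bad_split : forall x y w, bad x y -> mates V i x w ->
     ham x w <= D -> ham w y <= D -> bad x w \/ bad w y).

Lemma step_flip x s : flip (step x i) s = step (flip x s) i.
Proof. by rewrite -!flip1 flipC. Qed.

Lemma bad_notin x y s : bad x y -> flip x s = y -> i \notin s.
Proof.
move=> /bad_mates[_ _ _ _ e] f; move: e; rewrite -f flipE.
by case: (x i); case: (i \in s).
Qed.

Section Pair.
Variables (x y : cube) (s t : seq I).
Hypotheses (bxy : bad x y) (gs : geo V x s) (es : flip x s = y)
  (gt : geo V (step x i) t) (et : flip (step x i) t = step y i).

Lemma ladder_size : size s = D /\ size t = D.
Proof.
rewrite -(bad_ham bxy) -(ham_step2 x y i) -{1}es -et ham_flip ?(proj1 gt) //.
by rewrite ham_step2 ham_flip ?(proj1 gs).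
Qed.

Lemma ladder_eqi : s =i t.
Proof. by apply: (@flip_mem _ (step x i)); rewrite et step_flip es. Qed.

Lemma ladder_notin : i \notin s /\ i \notin t.
Proof. by rewrite -ladder_eqi (bad_notin bxy es). Qed.

Lemma ladder_side p : flip x (take p s) i = x i.
Proof.
rewrite flipE; case it: (i \in _); rewrite ?addbF //.
by have [/negP[]] := ladder_notin; apply: mem_take it.
Qed.

Lemma ladder_side' p : flip (step x i) (take p t) i = ~~ x i.
Proof.
rewrite flipE stepE eqxx addbT; case it: (i \in _); rewrite ?addbF //.
by have [_ /negP[]] := ladder_notin; apply: mem_take it.
Qed.

(** The first two bounds go round the ladder either way. The next two add the triangle inequalities
    for [w] on both sides of i. Together they put [w] within [D] of both [x] and [y], which is what
    [bad_split] asks for. *)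
Lemma ladder_bounds p q w : p <= D -> q <= D ->
  let u := flip x (take p s) in let v := flip (step x i) (take q t) in
  w \in V -> step w i \in V -> w i = x i -> ham u w + 1 + ham (step w i) v = ham u v ->
  [/\ ham u v <= p + q + 1, ham u v <= (D - p) + (D - q) + 1,
      2 * ham x w + 2 <= (p + q + 1) + ham u v,
      2 * ham w y + 2 <= ((D - p) + (D - q) + 1) + ham u v & bad x w \/ bad w y].
Proof.
move=> pD qD u v wV wV' wi e; have [sD tD] := ladder_size.
have xu : ham x u = p by rewrite ham_flip ?take_uniq ?(proj1 gs) // size_takel ?sD.
have xv : ham (step x i) v = q by rewrite ham_flip ?take_uniq ?(proj1 gt) // size_takel ?tD.
have uy : ham u y = D - p.
  by rewrite -es -(flip_take x p (proj1 gs)) ham_flip ?drop_uniq ?(proj1 gs) // size_drop sD.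
have vy : ham v (step y i) = D - q.
  by rewrite -et -(flip_take _ q (proj1 gt)) ham_flip ?drop_uniq ?(proj1 gt) // size_drop tD.
have h1 := ham_tri x u v; have h2 := ham_tri (step x i) x v.
have h3 := ham_tri y u v; have h4 := ham_tri (step y i) y v.
have h5 := ham_tri u x w; have h6 := ham_tri v (step x i) (step w i).
have h7 := ham_tri u w y; have h8 := ham_tri v (step w i) (step y i).
rewrite ham_step2 in h6; rewrite ham_step2 in h8; rewrite ham_step in h2; rewrite ham_step in h4.
rewrite (hamC u x) in h1; rewrite (hamC (step y i) v) in h4; rewrite (hamC v (step w i)) in h6.
rewrite (hamC w u) in h7.
have b1 : ham u v <= p + q + 1 by alia.
have b2 : ham u v <= (D - p) + (D - q) + 1 by alia.
have b3 : 2 * ham x w + 2 <= (p + q + 1) + ham u v by alia.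
have b4 : 2 * ham w y + 2 <= ((D - p) + (D - q) + 1) + ham u v by alia.
split=> //; apply: (bad_split bxy); [|by alia|by alia].
by have [xV xV' _ _ _] := bad_mates bxy; split.
Qed.

Lemma ladder_cross p q z : let u := flip x (take p s) in let v := flip (step x i) (take q t) in
  z \in V -> btw u z v ->
  exists w, [/\ w \in V, step w i \in V, w i = x i,
    ham u w + 1 + ham (step w i) v = ham u v &
    (z i = u i -> btw u z w) /\ (z i = v i -> btw (step w i) z v)].
Proof.
move=> u v zV b; have [|w [wV wV' wi e h]] := @cross _ V i u z v wgV (proj2 gs p) zV (proj2 gt q) b.
  by rewrite ladder_side ladder_side'; case: (x i).
by exists w; split=> //; rewrite wi ladder_side.
Qed.

(** A geodesic shorter than both ways round the ladder would cross class i at some [w] closer than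
    [D] to both [x] and [y], and neither half could be bad. *)
Lemma ladder_isometric p q : p <= D -> q <= D ->
  let u := flip x (take p s) in let v := flip (step x i) (take q t) in
  ~ (ham u v < p + q + 1 /\ ham u v < (D - p) + (D - q) + 1).
Proof.
move=> pD qD u v [l1 l2].
have b : btw u u v by [].
have [w [wV wV' wi e _]] := ladder_cross (proj2 gs p) b.
have [_ _ h1 h2] := ladder_bounds pD qD wV wV' wi e.
rewrite -/u -/v in h1 h2.
by case=> /bad_ham h; alia.
Qed.

(** Let a class occur at position p in [s] and q in [t]. If the prefixes before it shared a class,
    the two vertices there would be closer than both ways round the ladder, since the remainders
    share the class itself. So the prefixes are disjoint, and likewise the suffixes; counting both
    gives p + q = [D.-1]. *)
Lemma ladder_rev : t = rev s.
Proof.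
have [sD tD] := ladder_size; have [us _] := gs; have [ut _] := gt.
have key : forall a, a \in s -> index a s + index a t = D.-1.
  move=> a sa; have ta : a \in t by rewrite -ladder_eqi.
  have ip : index a s < D by rewrite -sD index_mem.
  have iq : index a t < D by rewrite -tD index_mem.
  set p := index a s in ip *; set q := index a t in iq *.
  have ip' : p <= D by apply: ltnW.
  have iq' : q <= D by apply: ltnW.
  have sp : take p.+1 s = rcons (take p s) a.
    by rewrite (take_nth a) ?index_mem // nth_index.
  have tq : take q.+1 t = rcons (take q t) a.
    by rewrite (take_nth a) ?index_mem // nth_index.
  have sp' : drop p s = a :: drop p.+1 s.
    by rewrite (drop_nth a) ?index_mem // nth_index.
  have tq' : drop q t = a :: drop q.+1 t.
    by rewrite (drop_nth a) ?index_mem // nth_index.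
  have stp : forall u v, ham u (step v i) <= ham u v + 1.
    by move=> u v; have := ham_tri v u (step v i); rewrite ham_step.
  have htake : forall p' q', p' <= D -> q' <= D -> forall b, b \in take p' s -> b \in take q' t ->
      ham (flip x (take p' s)) (flip (step x i) (take q' t)) < p' + q' + 1.
    move=> p' q' hp hq b bs bt; rewrite step_flip.
    have h1 := stp (flip x (take p' s)) (flip x (take q' t)).
    have h2 := ham_flips_common x (take_uniq p' us) (take_uniq q' ut) bs bt.
    rewrite !size_takel ?sD ?tD // in h2; alia.
  have hdrop : forall p' q', p' <= D -> q' <= D -> forall b, b \in drop p' s -> b \in drop q' t ->
      ham (flip x (take p' s)) (flip (step x i) (take q' t)) < (D - p') + (D - q') + 1.
    move=> p' q' hp hq b bs bt; rewrite step_flip -(flip_drop x _ us).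
    have -> : flip x (take q' t) = flip (flip x s) (drop q' t).
      by rewrite (flip_eqi x ladder_eqi) flip_drop.
    have h1 := stp (flip (flip x s) (drop p' s)) (flip (flip x s) (drop q' t)).
    have h2 := ham_flips_common (flip x s) (drop_uniq p' us) (drop_uniq q' ut) bs bt.
    rewrite !size_drop ?sD ?tD // in h2; alia.
  have cnt : forall c d, uniq (c ++ d) -> {subset c ++ d <= rem a s} -> size c + size d <= D.-1.
    move=> c d ucd sub; rewrite -size_cat -sD -(size_rem sa).
    exact: uniq_leq_size.
  have rs : rem a s =i [predD1 s & a] by apply: mem_rem_uniq.
  have le : p + q <= D.-1.
    have -> : p + q = size (take p s) + size (take q t).
      by rewrite !size_takel ?sD ?tD.
    apply: cnt => [|b].
      rewrite cat_uniq !take_uniq // andbT /=; apply/hasPn => b bt; apply/negP => bs.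
      apply: (ladder_isometric ip' iq'); split; first exact: (htake _ _ ip' iq' b).
      by apply: (hdrop _ _ ip' iq' a); rewrite ?sp' ?tq' mem_head.
    rewrite mem_cat rs inE => /orP[] h.
      rewrite (mem_take h) andbT; apply: contraTneq h => ->.
      by have := take_uniq p.+1 us; rewrite sp rcons_uniq => /andP[].
    rewrite ladder_eqi (mem_take h) andbT; apply: contraTneq h => ->.
    by have := take_uniq q.+1 ut; rewrite tq rcons_uniq => /andP[].
  have ge : (D - p.+1) + (D - q.+1) <= D.-1.
    have -> : (D - p.+1) + (D - q.+1) = size (drop p.+1 s) + size (drop q.+1 t).
      by rewrite !size_drop sD tD.
    apply: cnt => [|b].
      rewrite cat_uniq !drop_uniq // andbT /=; apply/hasPn => b bt; apply/negP => bs.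
      apply: (ladder_isometric ip iq); split; last exact: (hdrop _ _ ip iq b).
      by apply: (htake _ _ ip iq a); rewrite ?sp ?tq mem_rcons mem_head.
    rewrite mem_cat rs inE => /orP[] h.
      rewrite (mem_drop h) andbT; apply: contraTneq h => ->.
      by have := drop_uniq p us; rewrite sp' /= => /andP[].
    rewrite ladder_eqi (mem_drop h) andbT; apply: contraTneq h => ->.
    by have := drop_uniq q ut; rewrite tq' /= => /andP[].
  by alia.
(* [nth] needs a default class, which a ladder of positive length provides. *)
case D0 : D => [|d].
  by move: sD tD; rewrite D0; case: (s) => //; case: (t).
have [a0 _] : exists a0 : I, true by move: sD; rewrite D0; case: (s) => // a; exists a.
apply: (@eq_from_nth _ a0); first by rewrite size_rev sD tD.
move=> q; rewrite tD => qD; rewrite nth_rev ?sD //.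
have qt : nth a0 t q \in t by rewrite mem_nth ?tD.
have := key (nth a0 t q); rewrite ladder_eqi => /(_ qt).
rewrite index_uniq ?tD // => h.
have qs : nth a0 t q \in s by rewrite ladder_eqi.
rewrite -[LHS](nth_index a0 qs); congr nth; alia.
Qed.

End Pair.

Lemma bad_geo x y : bad x y -> exists2 s, geo V x s & flip x s = y.
Proof. by move=> /bad_mates[? _ ? _ _]; apply: geo_ex. Qed.

Lemma bad_geo' x y : bad x y -> exists2 s, geo V (step x i) s & flip (step x i) s = step y i.
Proof. by move=> /bad_mates[_ ? _ ? _]; apply: geo_ex. Qed.

(** Both geodesics are reversals of one geodesic on the other side of i. *)
Lemma ladder_unique x y s s' : bad x y -> geo V x s -> flip x s = y ->
  geo V x s' -> flip x s' = y -> s = s'.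
Proof.
move=> b gs es gs' es'; have [t gt et] := bad_geo' b.
by apply: (can_inj revK); rewrite -(ladder_rev b gs es gt et) -(ladder_rev b gs' es' gt et).
Qed.

Lemma ladder_rev_geo x y s : bad x y -> geo V x s -> flip x s = y -> geo V (step x i) (rev s).
Proof.
by move=> b gs es; have [t gt et] := bad_geo' b; rewrite -(ladder_rev b gs es gt et).
Qed.

Lemma ladder_unique' x y s t : bad x y -> geo V x s -> flip x s = y ->
  geo V (step x i) t -> flip (step x i) t = step y i -> t = rev s.
Proof. by move=> b gs es gt et; rewrite (ladder_rev b gs es gt et). Qed.

(* A geodesic between the two sides of the ladder that leaves it gives a second ladder,
   from w to y, of the same length; comparing the two sequences of classes forces w = x *)
Lemma ladder_end x y s p q w : bad x y -> geo V x s -> flip x s = y -> p <= D -> q <= D ->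
  let u := flip x (take p s) in let v := flip (step x i) (take q (rev s)) in
  w \in V -> step w i \in V -> w i = x i -> ham u w + 1 + ham (step w i) v = ham u v ->
  bad w y -> w = x.
Proof.
move=> b gs es pD qD u v wV wV' wi e bw.
have gt := ladder_rev_geo b gs es.
have et : flip (step x i) (rev s) = step y i.
  by rewrite (flip_eqi _ (mem_rev s)) -!flip1 flipC es.
have [sD tD] := ladder_size b gs es gt et.
have [h1 h2 h3 h4 _] := ladder_bounds b gs es gt et pD qD wV wV' wi e.
rewrite -/u -/v in h1 h2 h3 h4.
have us := proj1 gs; have ut := proj1 gt.
have uy : ham u y = D - p.
  by rewrite -es -(flip_take x p us) ham_flip ?drop_uniq // size_drop sD.
have vy : ham v (step y i) = D - q.
  by rewrite -et -(flip_take _ q ut) ham_flip ?drop_uniq // size_drop tD.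
have hw := bad_ham bw; have hw' := hw; rewrite -(ham_step2 w y i) in hw'.
have t1 := ham_tri u w y; have t2 := ham_tri v (step w i) (step y i).
rewrite (hamC u w) in e.
have huv : ham u v = p + q + 1 by alia.
have pq : p + q <= D by alia.
have wu : ham w u = p by alia.
have wv : ham (step w i) v = q by alia.
have b1 : btw w u y by apply/ham_btw; alia.
have b2 : btw (step w i) v (step y i) by apply/ham_btw; alia.
have [r gr er] := geo_ex wgV wV (proj2 gs p : u \in V).
have [r' gr' er'] := geo_ex wgV wV' (proj2 gt q : v \in V).
have sr : size r = p by rewrite -wu -er ham_flip // (proj1 gr).
have sr' : size r' = q by rewrite -wv -er' ham_flip // (proj1 gr').
have [G1 E1] : geo V w (r ++ drop p s) /\ flip w (r ++ drop p s) = y.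
  apply: geo_btw => //; rewrite er //; last by rewrite flip_take.
  exact: geo_drop.
have [G2 E2] : geo V (step w i) (r' ++ drop q (rev s)) /\
     flip (step w i) (r' ++ drop q (rev s)) = step y i.
  apply: geo_btw => //; rewrite er' //; last by rewrite flip_take.
  exact: geo_drop.
(* The two sides of the ladder from [w] to [y] are reversals of each other. Past the first [D - p]
   classes one reads [rev (take p s)] and the other [rev r], so [w] and [x] reach [u] by the same
   flips. *)
have := ladder_unique' bw G1 E1 G2 E2; rewrite rev_cat => /(congr1 (drop (D - p))).
rewrite drop_cat sr' ltnNge (_ : q <= D - p); last by alia.
rewrite /= drop_drop subnK; last by alia.
rewrite drop_size_cat ?size_rev ?size_drop ?sD // drop_rev sD subKn // => /(congr1 rev).
by rewrite !revK => sr1; rewrite -[LHS](flipK w r) er -sr1 /u flipK.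
Qed.

Lemma oncyc_rcons x s j :
  oncyc x (rcons s i) (flip x (take j s)).
Proof.
exists (minn j (size s)); left; rewrite -cats1 take_cat; case: ltnP => h.
  by case: (leqP j (size s)) h => // h; rewrite ltnn.
have -> : minn j (size s) - size s = 0 by alia.
by rewrite take0 cats0 take_oversize //; alia.
Qed.

Lemma oncyc_rcons' x s j : i \notin s -> uniq s ->
  oncyc x (rcons s i) (flip (step x i) (take j (rev s))).
Proof.
move=> si us; exists (size s - j); right; rewrite -cats1 drop_cat.
have -> : flip (step x i) (take j (rev s)) = flip x (drop (size s - j) s ++ [:: i]).
  rewrite take_rev (flip_eqi _ (mem_rev _)) step_flip -flip1 -flip_cat //.
  rewrite cats1 rcons_uniq drop_uniq // andbT; apply: contra si; exact: mem_drop.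
case: ltnP => // h; have -> : size s - j = size s by alia.
by rewrite drop_size subnn drop0.
Qed.

Lemma on_ladder x s z : uniq s -> i \notin s -> oncyc x (rcons s i) z ->
  exists2 j, j <= size s & z = flip x (take j s) \/ z = flip (step x i) (take j (rev s)).
Proof.
move=> us si; have U : uniq (rcons s i) by rewrite rcons_uniq si.
have E : forall k : nat, flip x (drop k s ++ [:: i]) = flip (step x i) (drop k s).
  move=> k; rewrite step_flip -flip1 flip_cat // cats1 rcons_uniq drop_uniq // andbT.
  apply: contra si; exact: mem_drop.
have R : forall k : nat, flip (step x i) (drop k s) = flip (step x i) (take (size s - k) (rev s)).
  move=> k; rewrite take_rev (flip_eqi _ (mem_rev _)); congr flip.
  by case: (leqP k (size s)) => h; [rewrite subKn | rewrite !drop_oversize //; alia].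
case=> j; rewrite -cats1 take_cat drop_cat; case: ltnP => h [] ->.
- by exists j; [apply: ltnW | left].
- by exists (size s - j); [apply: leq_subr | right; rewrite E R].
- case: (posnP (j - size s)) => h'.
    by exists (size s); rewrite // h' take0 cats0 take_size; left.
  exists (size s) => //; right; rewrite (take_oversize (s := [:: i])) //.
  by have := E 0; rewrite R drop0 subn0.
case: (posnP (j - size s)) => h'.
  by exists 0 => //; right; rewrite take0 h' drop0 flip0 flip1.
by exists 0 => //; left; rewrite take0 drop_oversize.
Qed.

Lemma ladder_cyc x y s : bad x y -> geo V x s -> flip x s = y -> cyc V x (rcons s i).
Proof.
move=> b gs es; have gt := ladder_rev_geo b gs es.
have us := proj1 gs; have si := bad_notin b es.
have U : uniq (rcons s i) by rewrite rcons_uniq si.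
split=> // j.
have A : forall z, oncyc x (rcons s i) z -> z \in V.
  move=> z /(on_ladder us si)[k _ [] ->]; first exact: (proj2 gs).
  exact: (proj2 gt).
by split; apply: A; exists j; [left|right].
Qed.

(** Between vertices on one side, convexity is uniqueness of geodesics. Between the two sides, a
    geodesic crosses class i at some [w], which [ladder_end] forces to be [x] or [y]; then both of
    its parts lie on the ladder. *)
Lemma ladder_ccyc x y s : x != y -> bad x y -> geo V x s -> flip x s = y ->
  ccyc V x (rcons s i).
Proof.
move=> xy b gs es; have gt := ladder_rev_geo b gs es.
have et : flip (step x i) (rev s) = step y i.
  by rewrite (flip_eqi _ (mem_rev s)) -!flip1 flipC es.
have us := proj1 gs; have si := bad_notin b es; have ut := proj1 gt.
have [sD tD] := ladder_size b gs es gt et.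
have top : forall z, z \in V -> btw x z y -> oncyc x (rcons s i) z.
  move=> z zV bz; have [xV _ yV _ _] := bad_mates b.
  have [r gr er] := geo_ex wgV xV zV; have [r' gr' er'] := geo_ex wgV zV yV.
  have [] := @geo_btw _ V x y r r' gr; rewrite ?er // => G E.
  rewrite -er -(take_size_cat r' (erefl (size r))) -(ladder_unique b gs es G E).
  exact: oncyc_rcons.
have bot : forall z, z \in V -> btw (step x i) z (step y i) -> oncyc x (rcons s i) z.
  move=> z zV bz; have [_ xV _ yV _] := bad_mates b.
  have [r gr er] := geo_ex wgV xV zV; have [r' gr' er'] := geo_ex wgV zV yV.
  have [] := @geo_btw _ V (step x i) (step y i) r r' gr; rewrite ?er // => G E.
  rewrite -er -(take_size_cat r' (erefl (size r))) (ladder_unique' b gs es G E).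
  exact: oncyc_rcons'.
have btop : forall p, btw x (flip x (take p s)) y.
  move=> p k; rewrite -es !flipE; case: (boolP (k \in s)); first by case: (x k).
  by move=> ks _; rewrite (contraNF (@mem_take _ _ _ _) ks) addbF.
have bbot : forall p, btw (step x i) (flip (step x i) (take p (rev s))) (step y i).
  move=> p k; rewrite -et !flipE; case: (boolP (k \in rev s)); first by case: (step x i k).
  by move=> ks _; rewrite (contraNF (@mem_take _ _ _ _) ks) addbF.
have mixed : forall p q z, p <= D -> q <= D -> z \in V ->
    btw (flip x (take p s)) z (flip (step x i) (take q (rev s))) -> oncyc x (rcons s i) z.
  move=> p q z pD qD zV bz.
  have [w [wV wV' wi e [z1 z2]]] := ladder_cross b gs es gt et zV bz.
  have side : w = x \/ w = y -> oncyc x (rcons s i) z.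
    move=> wxy; have wt : btw x w y by case: wxy => ->.
    have wb : btw (step x i) (step w i) (step y i) by case: wxy => ->.
    have [zi|zi] := eqVneq (z i) (x i).
      apply: top => //; apply: (btw_hull (btop p) wt); apply: z1.
      by rewrite zi (ladder_side b es et).
    apply: bot => //; apply: (btw_hull wb (bbot q)); apply: z2.
    by rewrite (ladder_side' b es et); move: zi; case: (z i); case: (x i).
  have [_ _ _ _ [bw|bw]] := ladder_bounds b gs es gt et pD qD wV wV' wi e; apply: side; last first.
    by left; apply: (ladder_end b gs es pD qD wV wV' wi e bw).
  (* The same ladder read from [y], where positions p and q become [D - p] and [D - q]. *)
  right; apply: (@ladder_end y x (rev s) (D - p) (D - q) w (badC b)).
  - by rewrite -es; apply: geo_rev.
  - by rewrite -es flip_rev.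
  - exact: leq_subr.
  - exact: leq_subr.
  - by [].
  - by [].
  - by rewrite wi; have [] := bad_mates b.
  - have -> : flip y (take (D - p) (rev s)) = flip x (take p s).
      by rewrite take_rev (flip_eqi _ (mem_rev _)) sD subKn // -es flip_drop.
    have -> : flip (step y i) (take (D - q) (rev (rev s))) = flip (step x i) (take q (rev s)).
      by rewrite take_rev (flip_eqi _ (mem_rev _)) tD subKn // -et flip_drop.
    exact: e.
  exact: badC.
split; first exact: (ladder_cyc b gs es).
  rewrite size_rcons ltnS lt0n sD -(bad_ham b); apply: contra xy.
  by rewrite ham_eq0.
move=> u v z /(on_ladder us si)[p]; rewrite sD => pD [] -> /(on_ladder us si)[q]; rewrite sD;
  move=> qD [] -> zV bz.
- by apply: top => //; apply: (btw_hull (btop p) (btop q) bz).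
- exact: (mixed p q).
- by apply: (mixed q p) => //; apply: btw_sym.
by apply: bot => //; apply: (btw_hull (bbot p) (bbot q) bz).
Qed.

End Ladder.

(** * Sequences that differ in one middle segment *)

Lemma index_rev (T : eqType) (s : seq T) h : uniq s -> h \in s ->
  index h (rev s) = (size s).-1 - index h s.
Proof.
move=> us hs; have l : index h s < size s by rewrite index_mem.
have l' : (size s).-1 - index h s < size (rev s) by rewrite size_rev; alia.
rewrite -[RHS](@index_uniq _ h _ (rev s)) ?rev_uniq //; congr index.
rewrite nth_rev; last by move: l'; rewrite size_rev.
have -> : size s - ((size s).-1 - index h s).+1 = index h s by alia.
by rewrite nth_index.
Qed.

Lemma take_index (T : eqType) (s : seq T) h : h \in s ->
  take (index h s).+1 s = rcons (take (index h s) s) h.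
Proof. by move=> hs; rewrite (take_nth h) ?index_mem // nth_index. Qed.

(** Cut off the longest common prefix and then the longest common suffix. By hypothesis an entry
    common to both sequences lies in one of these, so the middle segments are disjoint. *)
Lemma seq_split (T : eqType) (c d : seq T) : size c = size d -> c <> d -> uniq c ->
  (forall h, h \in c -> h \in d ->
     take (index h c).+1 c = take (index h d).+1 d \/ drop (index h c) c = drop (index h d) d) ->
  exists a g b e, [/\ c = a ++ g ++ b, d = a ++ e ++ b, size g = size e, 0 < size g &
    forall h, h \in g -> h \notin e].
Proof.
move=> sz ne uc common.
have exP : exists p, (p <= size c) && (take p c == take p d) by exists 0; rewrite !take0 eqxx.
have bdP : forall p, (p <= size c) && (take p c == take p d) -> p <= size c by move=> p /andP[].
case: (ex_maxnP exP bdP) => p /andP[pc /eqP tp] maxp.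
(* Requiring [p <= q] keeps the common suffix from overlapping the common prefix. *)
have exQ : exists q, (p <= q <= size c) && (drop q c == drop q d).
  by exists (size c); rewrite pc leqnn drop_size sz drop_size eqxx.
case: (ex_minnP exQ) => q /andP[/andP[pq qc] /eqP dq] minq.
have split3 : forall s : seq T, s = take p s ++ take (q - p) (drop p s) ++ drop q s.
  by move=> s; rewrite -{2}(subnK pq) -drop_drop !cat_take_drop.
have sg : size (take (q - p) (drop p c)) = q - p by rewrite size_takel // size_drop; alia.
have se : size (take (q - p) (drop p d)) = q - p by rewrite size_takel // size_drop; alia.
exists (take p c), (take (q - p) (drop p c)), (drop q c), (take (q - p) (drop p d)).
split; [exact: split3 | by rewrite tp dq; apply: split3 | by rewrite sg se | |].
  rewrite sg lt0n subn_eq0 -ltnNge ltn_neqAle pq andbT; apply/eqP => epq; apply: ne.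
  by rewrite -(cat_take_drop p c) -(cat_take_drop p d) tp [in drop p c]epq dq -epq.
move=> h hg; apply/negP => he.
have hc : h \in c by rewrite (split3 c) !mem_cat hg !orbT.
have hd : h \in d by rewrite (split3 d) !mem_cat he !orbT.
have /andP[iq1 iq2] : p <= index h c < q.
  have hp : h \notin take p c.
    move: uc; rewrite {1}(split3 c) cat_uniq => /and3P[_ /hasPn/(_ h) + _].
    by rewrite mem_cat hg => /(_ isT).
  rewrite {1 2}(split3 c) !index_cat (negbTE hp) hg size_takel // leq_addr /=.
  by move: hg; rewrite -index_mem sg; alia.
have lc : index h c < size c by rewrite index_mem.
have ld : index h d < size d by rewrite index_mem.
case: (common h hc hd) => e.
  have E : index h c = index h d by move/(congr1 size): e; rewrite !size_takel //; alia.
  have : (index h c).+1 <= p by apply: maxp; rewrite lc {2}E e eqxx.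
  alia.
have E : index h c = index h d by move/(congr1 size): e; rewrite !size_drop; alia.
have : q <= index h c by apply: minq; rewrite {4}E e eqxx iq1 ltnW.
alia.
Qed.

(** * Girth, and intersections of convex cycles *)

Section Girth.
Variable I : finType.
Notation cube := {ffun I -> bool}.
Implicit Types (x y z u v w : cube) (s t c d : seq I) (i k h : I) (j p q r : nat).
Variables (V : {set cube}) (N : nat).
Hypotheses (wgV : well_graded V) (ccV : forall x s, ccyc V x s -> size s = N.+1).
Hypothesis N3 : 2 < N.

(** The rung i is one of the [N.+1] classes of the convex cycle, the other [N] are those of a
    side. *)
Lemma ladder_N i D (bad : cube -> cube -> Prop) x y :
  (forall x y, bad x y -> mates V i x y) -> (forall x y, bad x y -> ham x y = D) ->
  (forall x y, bad x y -> bad y x) ->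
  (forall x y w, bad x y -> mates V i x w -> ham x w <= D -> ham w y <= D -> bad x w \/ bad w y) ->
  x != y -> bad x y -> D = N.
Proof.
move=> h1 h2 h3 h4 xy b; have [s gs es] := bad_geo wgV h1 b.
have := ccV (ladder_ccyc wgV h1 h2 h3 h4 xy b gs es).
by rewrite size_rcons -(h2 _ _ b) -es ham_flip ?(proj1 gs) // => -[].
Qed.

Lemma mates_trans i x y z : mates V i x y -> mates V i x z -> mates V i y z.
Proof. by case=> ? ? ? ? e [_ _ ? ? e']; split=> //; rewrite -e. Qed.

(** A shortest ladder cannot be split into two proper shorter ones, so it spans a convex cycle. *)
Lemma girth i x y : mates V i x y -> x != y -> N <= ham x y.
Proof.
have [d] := ubnP (ham x y); elim: d x y => // d IH x y le m xy.
rewrite leqNgt; apply/negP => lN.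
have IH' : forall u v, mates V i u v -> u != v -> ham u v < ham x y -> False.
  move=> u v muv uv l; have l' : ham u v < d by alia.
  by have := IH u v l' muv uv; alia.
suff : ham x y = N by alia.
apply: (@ladder_N i (ham x y) (fun u v => mates V i u v /\ ham u v = ham x y) x y) => //.
- by move=> u v [].
- by move=> u v [].
- by move=> u v [muv huv]; split; [apply: matesC | rewrite hamC].
move=> u v w [muv huv] muw h1 h2.
have [uw|uw] := eqVneq u w; first by right; rewrite -uw.
left; split=> //; have [l|l] := ltnP (ham u w) (ham x y); last by alia.
by case: (IH' u w muw uw l).
Qed.

Lemma girth_eq i x y : mates V i x y -> ham x y < N -> x = y.
Proof.
by move=> m l; apply/eqP; apply: contraTT l => xy; rewrite -leqNgt; apply: (girth m).
Qed.

(** By [girth] the length [N] is minimal, so all ladders of length [N] may be taken as the bad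
    ones. *)
Lemma N_split i x y w : mates V i x y /\ ham x y = N -> mates V i x w -> ham x w <= N ->
  ham w y <= N -> (mates V i x w /\ ham x w = N) \/ (mates V i w y /\ ham w y = N).
Proof.
move=> [m e] mw l _; have [xw|xw] := eqVneq x w; first by right; rewrite -xw.
by left; split=> //; have := girth mw xw; alia.
Qed.

Lemma mate_cyc i x y s : mates V i x y -> ham x y = N -> geo V x s -> flip x s = y ->
  cyc V x (rcons s i).
Proof.
move=> m e gs es.
apply: (@ladder_cyc _ V i N (fun u v => mates V i u v /\ ham u v = N)) es => //.
- by move=> u v [].
- by move=> u v [].
- exact: N_split.
Qed.

Lemma mate_uniq i x y s t : mates V i x y -> ham x y = N -> geo V x s -> flip x s = y ->
  geo V x t -> flip x t = y -> s = t.
Proof.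
move=> m e gs es gt et.
apply: (@ladder_unique _ V i N (fun u v => mates V i u v /\ ham u v = N)) gs es gt et => //.
- by move=> u v [].
- by move=> u v [].
- exact: N_split.
Qed.

Lemma cyc_rot1 x i s : cyc V x (i :: s) -> cyc V (step x i) (rcons s i).
Proof. by rewrite -cat1s => /cyc_rot; rewrite cats1 flip1. Qed.

Lemma cyc_rotr1 x i s : cyc V x (rcons s i) -> cyc V (step x i) (i :: s).
Proof. by rewrite -cats1 => /cyc_rotr; rewrite flip1. Qed.

Lemma cyc_rev1 x i s : cyc V x (i :: s) -> cyc V x (rcons (rev s) i).
Proof. by move/cyc_rev; rewrite rev_cons. Qed.

Lemma cyc_geo_rcons x s i : cyc V x (rcons s i) -> geo V x s.
Proof. by rewrite -cats1 => /cyc_geo/(@geo_take _ _ _ _ (size s)); rewrite take_size_cat. Qed.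

Lemma cyc_mates x s i : cyc V x (rcons s i) -> mates V i x (flip x s).
Proof.
move=> cx; have [us _] := cx; split.
- exact: cyc_mem cx.
- by move: cx; rewrite -cats1 => /cyc_drop; rewrite flip1.
- exact: geo_end (cyc_geo_rcons cx).
- by move: (cyc_geo cx) => /geo_end; rewrite -cats1 flip_cat ?cats1 // flip1.
by move: us; rewrite rcons_uniq flipE => /andP[/negbTE -> _]; rewrite addbF.
Qed.

Lemma cyc_ham x s i : cyc V x (rcons s i) -> ham x (flip x s) = size s.
Proof. by move=> /cyc_geo_rcons[us _]; rewrite ham_flip. Qed.

Lemma cyc_convex x s i : cyc V x (rcons s i) -> size s = N -> ccyc V x (rcons s i).
Proof.
move=> cx sN; have [m h] := (cyc_mates cx, cyc_ham cx).
apply: (@ladder_ccyc _ V i N (fun u v => mates V i u v /\ ham u v = N) _ _ _ _ _ x (flip x s)) => //.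
- by move=> u v [].
- by move=> u v [].
- by move=> u v [muv huv]; split; [apply: matesC | rewrite hamC].
- exact: N_split.
- by rewrite -ham_eq0 h sN; alia.
- by rewrite h.
exact: cyc_geo_rcons cx.
Qed.

Lemma cyc_uniq_geo x s t i : cyc V x (rcons s i) -> size s = N -> geo V x t ->
  flip x t = flip x s -> t = s.
Proof.
move=> cx sN gt e; apply: (mate_uniq (cyc_mates cx)) gt e _ _ => //.
  by rewrite (cyc_ham cx).
exact: cyc_geo_rcons cx.
Qed.

Lemma btw_take x s p : btw x (flip x (take p s)) (flip x s).
Proof.
move=> k; rewrite !flipE; case: (boolP (k \in s)); first by case: (x k).
by move=> ks _; rewrite (contraNF (@mem_take _ _ _ _) ks) addbF.
Qed.

(** Follow [d] to the common vertex and then [c]: this is again a geodesic to the end of [c], and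
    that geodesic is unique. *)
Lemma share_prefix w c d i p q : cyc V w (rcons c i) -> cyc V w (rcons d i) ->
  size c = N -> size d = N -> p <= N -> q <= N ->
  flip w (take p c) = flip w (take q d) -> take p c = take q d.
Proof.
move=> cc cd sc sd pN qN e.
have gc := cyc_geo_rcons cc; have gd := cyc_geo_rcons cd.
have pq : p = q.
  have := ham_flip w (take_uniq p (proj1 gc)); rewrite e ham_flip ?take_uniq ?(proj1 gd) //.
  by rewrite !size_takel ?sc ?sd.
have [||||G E] := @geo_btw _ V w (flip w c) (take q d) (drop p c).
- exact: geo_take.
- by rewrite -e; apply: geo_drop.
- by rewrite -e flip_take // (proj1 gc).
- by rewrite -e; apply: btw_take.
move/(congr1 (take p)): (cyc_uniq_geo cc sc G E).
by rewrite take_size_cat // size_takel ?sd.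
Qed.

Lemma geo_mates x s t h : geo V x s -> geo V x t -> h \in s -> h \in t ->
  mates V h (flip x (take (index h s) s)) (flip x (take (index h t) t)).
Proof.
have st : forall s, uniq s -> h \in s ->
    flip x (take (index h s).+1 s) = step (flip x (take (index h s) s)) h /\
    h \notin take (index h s) s.
  move=> r ur hr; have U := take_uniq (index h r).+1 ur; rewrite (take_index hr) in U *.
  split; last by move: U; rewrite rcons_uniq => /andP[].
  by rewrite -cats1 flip_cat ?cats1 // flip1.
move=> [us gs] [ut gt] hs ht; have [e1 n1] := st s us hs; have [e2 n2] := st t ut ht.
split; [exact: gs | by rewrite -e1; apply: gs | exact: gt | by rewrite -e2; apply: gt |].
by rewrite !flipE (negbTE n1) (negbTE n2).
Qed.

Lemma share_class1 w c d i h : cyc V w (rcons c i) -> cyc V w (rcons d i) ->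
  size c = N -> size d = N -> h \in c -> h \in d ->
  N <= index h c + index h d \/ take (index h c).+1 c = take (index h d).+1 d.
Proof.
move=> cc cd sc sd hc hd.
have gc := cyc_geo_rcons cc; have gd := cyc_geo_rcons cd.
have m := geo_mates gc gd hc hd.
have lc : index h c < N by rewrite -sc index_mem.
have ld : index h d < N by rewrite -sd index_mem.
have [l|l] := ltnP (index h c + index h d) N; [right|by left].
have := ham_flips_le w (take_uniq (index h c) (proj1 gc)) (take_uniq (index h d) (proj1 gd)).
rewrite !size_takel ?sc ?sd ?(ltnW lc) ?(ltnW ld) // => l'.
have e := girth_eq m (leq_ltn_trans l' l).
by rewrite !take_index // (share_prefix cc cd sc sd (ltnW lc) (ltnW ld) e).
Qed.

(* The edges of class h on one side of i are at distance at most p + q, those on the other side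
   at most 2(N - 1) - (p + q); so on some side they are closer than N and coincide *)
Lemma share_class v c d i h : cyc V v (i :: c) -> cyc V v (i :: d) ->
  size c = N -> size d = N -> h \in c -> h \in d ->
  take (index h c).+1 c = take (index h d).+1 d \/ drop (index h c) c = drop (index h d) d.
Proof.
move=> cc cd sc sd hc hd.
have uc : uniq c by have [/andP[]] := cc.
have ud : uniq d by have [/andP[]] := cd.
have lc : index h c < N by rewrite -sc index_mem.
have ld : index h d < N by rewrite -sd index_mem.
case: (share_class1 (cyc_rot1 cc) (cyc_rot1 cd) sc sd hc hd) => [l|]; [right|by left].
have := @share_class1 v (rev c) (rev d) i h (cyc_rev1 cc) (cyc_rev1 cd).
rewrite !size_rev !mem_rev !index_rev // sc sd => /(_ erefl erefl hc hd)[|].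
  by alia.
rewrite !take_rev sc sd (_ : N - (N.-1 - index h c).+1 = index h c); last by alia.
rewrite (_ : N - (N.-1 - index h d).+1 = index h d); last by alia.
exact: (can_inj revK).
Qed.

Lemma share_split v c d i : cyc V v (i :: c) -> cyc V v (i :: d) ->
  size c = N -> size d = N -> c <> d ->
  exists a g b e, [/\ c = a ++ g ++ b, d = a ++ e ++ b, size g = size e, 0 < size g &
    forall h, h \in g -> h \notin e].
Proof.
move=> cc cd sc sd ne; apply: seq_split => //; first by rewrite sc sd.
  by have [/andP[]] := cc.
by move=> h; apply: (share_class cc cd).
Qed.

(* Two convex cycles with exactly the path a in common, whose remaining classes are disjoint *)
Definition intertwined r : Prop := exists v a g e,
  [/\ cyc V v (a ++ g), cyc V v (a ++ e), 1 < size a, size a + r = N.+1 &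
  [/\ size g = r, size e = r, 0 < r & forall h, h \in g -> h \notin e]].

(** The common prefix and suffix lie on either side of i; a walk started at [flip v b] reads them as
    the single path [b ++ i :: a]. *)
Lemma split_intertwined v i a g b e : cyc V v (i :: a ++ g ++ b) -> cyc V v (i :: a ++ e ++ b) ->
  size (a ++ g ++ b) = N -> size g = size e -> 0 < size g -> 0 < size a + size b ->
  (forall h, h \in g -> h \notin e) -> intertwined (size g).
Proof.
move=> c1 c2; rewrite !size_cat => sz se g0 ab disj.
exists (flip v b), (b ++ i :: a), g, e; split=> //.
- by rewrite -catA; apply: cyc_rotr; rewrite !cat_cons -catA.
- by rewrite -catA; apply: cyc_rotr; rewrite !cat_cons -catA.
- by rewrite size_cat /=; alia.
- by rewrite size_cat /=; alia.
Qed.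

Lemma ham_split v a g b e : uniq (a ++ g ++ b) -> uniq (a ++ e ++ b) ->
  (forall h, h \in g -> h \notin e) ->
  ham (flip v (a ++ g ++ b)) (flip v (a ++ e ++ b)) = size g + size e.
Proof.
move=> u1 u2 disj.
have E : forall f, uniq (a ++ f ++ b) -> flip v (a ++ f ++ b) = flip (flip v (a ++ b)) f.
  move=> f uf; rewrite -flip_cat; first by apply: flip_eqi => k; rewrite !mem_cat orbA orbAC.
  by rewrite (@perm_uniq _ _ (a ++ f ++ b)) // -catA perm_cat2l perm_catC.
rewrite !E // ham_flips_disj // cat_uniq.
have -> : uniq g by move: u1; rewrite !cat_uniq => /and3P[_ _ /andP[]].
have -> : uniq e by move: u2; rewrite !cat_uniq => /and3P[_ _ /andP[]].
by rewrite andbT /=; apply/hasPn => k ke; apply/negP => /disj; rewrite ke.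
Qed.

(** If i and k differed, the edges opposite to the first edge of [s] on the two cycles would be
    distinct edges of one class at distance 2, below [N]. *)
Lemma long_share x s i k : cyc V x (rcons s i) -> cyc V x (rcons s k) -> size s = N -> i = k.
Proof.
move=> ci ck sN; apply/eqP; apply/negPn/negP => ik.
case: s sN ci ck => [|h s] /= sN ci ck; first by alia.
have [/andP[hsi ui] _] := ci; have [/andP[hsk uk] _] := ck.
have E : forall l, h \notin rcons s l -> uniq (rcons s l) -> cyc V x (h :: rcons s l) ->
   [/\ flip x (rcons s l) \in V, step (flip x (rcons s l)) h \in V & flip x (rcons s l) h = x h].
  move=> l hl ul cl; split.
  - by move: cl; rewrite -cat1s => /cyc_drop.
  - move: (geo_end (cyc_geo cl)); rewrite (@flip_eqi _ x _ (rcons s l ++ [:: h])).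
      by rewrite flip_cat ?flip1 // cats1 rcons_uniq hl.
    by move=> a; rewrite mem_cat inE !inE orbC.
  by rewrite flipE (negbTE hl) addbF.
have [a1 a2 a3] := E i hsi ui ci; have [b1 b2 b3] := E k hsk uk ck.
have m : mates V h (flip x (rcons s i)) (flip x (rcons s k)).
  by split=> //; rewrite a3 b3.
have hm : ham (flip x (rcons s i)) (flip x (rcons s k)) = 2.
  have := @ham_split x s [:: i] [::] [:: k]; rewrite !cats0 !cats1 => -> //.
  by move=> l; rewrite !inE => /eqP ->.
by have := hm; rewrite (girth_eq m) ?ham0 // hm.
Qed.


(** Take a shortest ladder below [2 * r] whose length is not [N]. If a third edge splits it, both
    halves have length [N] and span convex cycles through that edge. Cancelling what they share
    leaves disjoint segments of half the length of the ladder, hence an intertwined pair below r. *)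
Lemma mates_lt_girth r i x y : (forall r', r' < r -> ~ intertwined r') -> r < N ->
  mates V i x y -> x != y -> ham x y < 2 * r -> ham x y = N.
Proof.
move=> IHr rN; have [d] := ubnP (ham x y); elim: d x y => // d IH x y le m xy lr.
have IH' : forall u v, mates V i u v -> u != v -> ham u v < ham x y -> ham u v = N.
  by move=> u v muv uv l; apply: IH => //; [apply: leq_trans l _ | apply: ltn_trans l _].
apply: (@ladder_N i (ham x y) (fun u v => mates V i u v /\ ham u v = ham x y) x y) => //.
- by move=> u v [].
- by move=> u v [].
- by move=> u v [muv huv]; split; [apply: matesC | rewrite hamC].
move=> u v w [muv huv] muw h1 h2.
have [uw|uw] := eqVneq u w; first by right; rewrite -uw.
have [wv|wv] := eqVneq w v; first by left; rewrite wv.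
have mwv : mates V i w v := mates_trans muw muv.
have [e1|n1] := eqVneq (ham u w) (ham x y); first by left.
have [e2|n2] := eqVneq (ham w v) (ham x y); first by right.
have h1' : ham w u = N by rewrite hamC; apply: IH' => //; rewrite ltn_neqAle n1.
have h2' : ham w v = N by apply: IH' => //; rewrite ltn_neqAle n2.
have mwu := matesC muw; have [wV _ uV _ _] := mwu; have [_ _ vV _ _] := mwv.
have [c gc ec] := geo_ex wgV wV uV; have [f gf ef] := geo_ex wgV wV vV.
have sc : size c = N by rewrite -h1' -ec ham_flip // (proj1 gc).
have sf : size f = N by rewrite -h2' -ef ham_flip // (proj1 gf).
have cc := cyc_rotr1 (mate_cyc mwu h1' gc ec); have cf := cyc_rotr1 (mate_cyc mwv h2' gf ef).
have ne : c <> f.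
  by move=> E; move: huv; rewrite -ec -ef E ham0 => /esym/eqP; rewrite ham_eq0 (negbTE xy).
have [a [g [b [e [Ec Ef sge g0 disj]]]]] := share_split cc cf sc sf ne.
have hg : 2 * size g = ham x y.
  rewrite -huv -ec -ef Ec Ef ham_split // -?Ec -?Ef ?(proj1 gc) ?(proj1 gf) //.
  by rewrite -sge; alia.
case: (IHr (size g)); first by alia.
rewrite Ec in cc sc; rewrite Ef in cf.
apply: (split_intertwined cc cf) => //.
by move: sc; rewrite !size_cat; alia.
Qed.

Lemma cyc_rotr_cons v a s : cyc V v (a :: s) -> cyc V (flip v s) (rcons s a).
Proof. by rewrite -cat1s => /cyc_rotr; rewrite cats1. Qed.

Lemma mates_step i x y : mates V i x y -> mates V i (step x i) (step y i).
Proof. by case=> ? ? ? ? e; split; rewrite ?stepK // !stepE e. Qed.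

(** Otherwise the edge of class h at [x] and the one on the cycle after [s1] are distinct and closer
    than [N]. *)
Lemma cyc_corner x s1 h s2 : cyc V x (s1 ++ h :: s2) -> size (s1 ++ h :: s2) = N.+1 ->
  step x h \in V -> s1 = [::] \/ s2 = [::].
Proof.
case: s1 => [|a s1]; first by left.
case: s2 => [|b s2]; first by right.
move=> cx sz hV; have [ux _] := cx.
have hs : h \notin a :: s1.
  by move: ux; rewrite cat_uniq => /and3P[_ /hasPn/(_ h)]; rewrite mem_head => /(_ isT).
have us : uniq (a :: s1) by move: ux; rewrite cat_uniq => /and3P[].
have m : mates V h x (flip x (a :: s1)).
  split; [exact: cyc_mem cx | by [] | exact: cyc_take cx | |].
    have := @cyc_take _ V x ((a :: s1) ++ [:: h]) (b :: s2); rewrite -catA => /(_ cx).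
    by rewrite flip_cat ?flip1 // cats1 rcons_uniq hs.
  by rewrite flipE (negbTE hs) addbF.
have hm : ham x (flip x (a :: s1)) = (size s1).+1 by rewrite ham_flip.
suff e : x = flip x (a :: s1) by move: hm; rewrite -e ham0.
by apply: (girth_eq m); rewrite hm; move: sz; rewrite size_cat /=; alia.
Qed.

(** * Minimal intertwined pairs *)

Section Intertwined.
Variables (r : nat) (v : cube) (a b : I) (p g e : seq I).
Hypotheses (IHr : forall r', r' < r -> ~ intertwined r')
  (cg : cyc V v (a :: b :: p ++ g)) (ce : cyc V v (a :: b :: p ++ e))
  (szN : size p + 1 + r = N) (sg : size g = r) (se : size e = r) (r0 : 0 < r)
  (disj : forall h, h \in g -> h \notin e).

(** [x] and [y] are opposite, on the two cycles, to the common vertex of the shared edges a and b.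
    So both are incident with edges of class a and of class b. *)
Let x := flip v (b :: p ++ g).
Let y := flip v (b :: p ++ e).

Let opposite_mates : mates V a x y /\ mates V b x y.
Proof.
split.
  have m f : cyc V v (a :: b :: p ++ f) -> mates V a v (flip v (b :: p ++ f)).
    by move/cyc_rotr_cons/cyc_mates/matesC; rewrite flipK.
  exact: mates_trans (m _ cg) (m _ ce).
have m f : cyc V v (a :: b :: p ++ f) -> mates V b (step v a) (step (flip v (b :: p ++ f)) b).
  move=> cf; have [/andP[af /andP[bf _]] _] := cf.
  have := matesC (cyc_mates (cyc_rotr_cons (cyc_rot1 cf))); rewrite flipK.
  rewrite (_ : flip _ _ = step (flip v (b :: p ++ f)) b) //.
  apply/ffunP => k; rewrite !(stepE, flipE) mem_rcons !inE.
  move: af bf; rewrite !inE negb_or => /andP[ab af].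
  have [->|ka] := eqVneq k a; first by rewrite (negbTE ab) (negbTE af); case: (v a).
  have [->|kb] := eqVneq k b; last by rewrite !addbF.
  by move/negbTE => ->; case: (v b).
have := mates_step (mates_trans (m _ cg) (m _ ce)); by rewrite !stepK.
Qed.

Let uniq_g : uniq (a :: b :: p ++ g). Proof. by have [] := cg. Qed.
Let uniq_e : uniq (a :: b :: p ++ e). Proof. by have [] := ce. Qed.

Let ham_xy : ham x y = 2 * r.
Proof.
have := @ham_split v (b :: p) g [::] e; rewrite !cats0 => -> //; first by rewrite sg se; alia.
  by move: uniq_g => /andP[].
by move: uniq_e => /andP[].
Qed.

Let cx : cyc V x (rcons (b :: p ++ g) a). Proof. exact: cyc_rotr_cons. Qed.

(** [girth] gives the weak inequality. In case of equality one geodesic from [x] to [y] would close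
    up to a convex cycle both with a and with b, against [long_share]. *)
Lemma intertwined_far : N < 2 * r.
Proof.
have [ma mb] := opposite_mates.
have xy : x != y by rewrite -ham_eq0 ham_xy; alia.
have := girth ma xy; rewrite ham_xy leq_eqVlt => /orP[/eqP E|//].
have [xV _ yV _ _] := ma; have [k gk ek] := geo_ex wgV xV yV.
have hN : ham x y = N by rewrite ham_xy.
have sk : size k = N by rewrite -hN -ek ham_flip // (proj1 gk).
have := long_share (mate_cyc ma hN gk ek) (mate_cyc mb hN gk ek) sk.
by move=> ab; move: uniq_g; rewrite ab /= mem_head.
Qed.

(** Take the first class of a geodesic from [x] to [y]. It cannot belong to [g]: seen from [x], the
    extreme classes of the first cycle are a and b, and [cyc_corner] admits no others. *)
Lemma intertwined_next : exists2 h, h \in e & step x h \in V.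
Proof.
have [[xV _ yV _ _] _] := opposite_mates.
have [[|h k] gk ek] := geo_ex wgV xV yV.
  by have := ham_xy; rewrite -ek flip0 ham0; alia.
have hV : step x h \in V by have [_ /(_ 1)] := gk; rewrite /= take0 flip1.
have hxy : x h != y h by rewrite -ek flipE mem_head; case: (x h).
case: (boolP (h \in e)) => he; first by exists h.
have hg : h \in g.
  move: hxy; rewrite /x /y !flipE !inE !mem_cat (negbTE he) orbF.
  by case: (h \in g); rewrite // !orbF eqxx.
case/splitPr: hg cx sg => g1 g2 cx' sg'.
have E : rcons (b :: p ++ g1 ++ h :: g2) a = (b :: p ++ g1) ++ h :: rcons g2 a.
  by rewrite /= catA rcons_cat.
rewrite E in cx'; case: (cyc_corner cx' _ hV) => //.
  by rewrite -E size_rcons /= size_cat sg'; alia.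
by case: (g2).
Qed.

(* The edge of class h at x and the edge of class h on the second cycle are at distance N.  The
   cycle they span shares a path of length r + 1 with the first cycle, more than the intertwined
   pair does, against the minimality of r *)
Lemma intertwined_False : False.
Proof.
have [h he hV] := intertwined_next; have far := intertwined_far.
have hg : h \notin g by apply: contraL he => /disj.
have hp : h \notin a :: b :: p.
  move: uniq_e; rewrite -!cat_cons cat_uniq => /and3P[_ /hasPn/(_ h he) //].
have hx : x h = v h.
  rewrite /x flipE inE mem_cat (negbTE hg) orbF.
  by move: hp; rewrite !inE !negb_or => /and3P[_ /negbTE -> /negbTE ->]; rewrite addbF.
case/splitPr: he (ce) (se) (uniq_e) (disj) => e1 e2 ce' se' ue' disj'.
have ux : uniq (rcons (b :: p ++ g) a) by have [] := cx.
(* If h is the last class of [e], then [v] itself is on an edge of class h at distance [N] from [x],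
   and [long_share] would identify h with a. *)
case: e2 ce' se' ue' disj' => [|h' e2] ce' se' ue' disj'.
  have hvV : step v h \in V.
    by have := @cyc_drop _ V v (a :: b :: p ++ e1) [:: h]; rewrite /= -catA flip1; apply.
  have m : mates V h x v by split=> //; [exact: cyc_mem cx | exact: cyc_mem cg].
  have gx : geo V x (b :: p ++ g) := cyc_geo_rcons cx.
  have hN : ham x v = N.
    by rewrite hamC /x ham_flip ?(proj1 gx) //= size_cat sg; alia.
  have ex : flip x (b :: p ++ g) = v by rewrite /x flipK.
  have sN : size (b :: p ++ g) = N by rewrite /= size_cat sg; alia.
  have ah := long_share cx (mate_cyc m hN gx ex) sN.
  by move: hp; rewrite -ah mem_head.
set e2' := h' :: e2 in ce' se' ue' disj'.
have ge' : geo V v ((a :: b :: p) ++ e1 ++ h :: e2') := cyc_geo ce'.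
have se1 : (size e1).+2 <= r by move: se'; rewrite size_cat /=; alia.
(* The route from [x] to the edge of class h on the second cycle: across a, back along [g] to the
   far end of the common path, then along [e1]. *)
have gx : geo V x (a :: rev g).
  have := cyc_geo (cyc_rev cx); rewrite rev_rcons rev_cons rev_cat rcons_cat.
  by move/(@geo_take _ V x _ (size (a :: rev g))); rewrite -cat_cons take_size_cat.
have ex : flip x (a :: rev g) = flip v (a :: b :: p).
  apply/ffunP => k; rewrite /x !flipE !inE mem_rev mem_cat.
  move: uniq_g; rewrite -!cat_cons cat_uniq => /and3P[/andP[ap _] /hasPn d _].
  have [->|ka] := eqVneq k a.
    have /negbTE ag : a \notin g by apply/negP => /d; rewrite /= mem_head.
    by move: ap; rewrite inE negb_or ag => /andP[/negbTE -> /negbTE ->]; rewrite !addbF.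
  case kg: (k \in g); last by rewrite /= !orbF addbF.
  by have := d _ kg; rewrite /= !inE (negbTE ka) /= !negb_or => /andP[/negbTE -> /negbTE ->]; case: (v k).
have gv1 : geo V (flip v (a :: b :: p)) e1.
  have := geo_drop (size (a :: b :: p)) ge'; rewrite take_size_cat // drop_size_cat //.
  by move/(@geo_take _ V _ _ (size e1)); rewrite take_size_cat.
have u1 : uniq ((a :: rev g) ++ e1).
  rewrite cat_uniq (proj1 gx) (proj1 gv1) andbT /=; apply/hasPn => k ke /=.
  rewrite inE mem_rev negb_or; apply/andP; split.
    apply: contraTneq ue' => ka; rewrite -ka /= inE mem_cat mem_cat ke /=.
    by rewrite !orbT.
  by apply/negP => /disj'; rewrite mem_cat ke.
set z := flip v ((a :: b :: p) ++ e1).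
have gxz : geo V x ((a :: rev g) ++ e1) by apply: geo_cat => //; rewrite ex.
have uz : uniq ((a :: b :: p) ++ e1).
  by move: (proj1 ge'); rewrite catA cat_uniq => /andP[].
have exz : flip x ((a :: rev g) ++ e1) = z by rewrite flip_cat // ex /z flip_cat.
have hz : h \notin (a :: b :: p) ++ e1.
  move: (proj1 ge'); rewrite catA cat_uniq => /and3P[_ /hasPn/(_ h)].
  by rewrite mem_head => /(_ isT).
have m : mates V h x z.
  split; [exact: cyc_mem cx | by [] | by rewrite -exz; apply: geo_end gxz | |].
    have := proj2 ge' (size (rcons ((a :: b :: p) ++ e1) h)).
    rewrite -cat_rcons catA -rcons_cat take_size_cat // -cats1 flip_cat ?flip1 //.
    by rewrite cats1 rcons_uniq hz.
  by rewrite hx /z flipE (negbTE hz) addbF.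
have hxz : ham x z = 1 + r + size e1.
  by rewrite -exz ham_flip // size_cat /= size_rev sg add1n.
have hN : ham x z = N.
  apply: (mates_lt_girth IHr _ m); rewrite ?hxz; [by alia | | by alia].
  by rewrite -ham_eq0 hxz.
have c1 := mate_cyc m hN gxz exz.
have c2 : cyc V x (a :: rev g ++ rev (b :: p)).
  by have := cyc_rev cx; rewrite rev_rcons -cat_cons rev_cat.
rewrite rcons_cat cat_cons in c1.
have s1 : size (rev g ++ rcons e1 h) = N by rewrite size_cat size_rev size_rcons sg; alia.
have s2 : size (rev g ++ rev (b :: p)) = N by rewrite size_cat !size_rev sg /=; alia.
have ne : rev g ++ rcons e1 h <> rev g ++ rev (b :: p).
  move=> E; have : h \in rev g ++ rev (b :: p) by rewrite -E mem_cat mem_rcons mem_head orbT.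
  rewrite mem_cat !mem_rev (negbTE hg) /=; move: hp; rewrite inE negb_or => /andP[_ /negbTE -> //].
have [a' [g' [b' [f' [E1 E2 sgf g0 dj]]]]] := share_split c1 c2 s1 s2 ne.
have U1 : uniq (a' ++ g' ++ b') by rewrite -E1; have [/andP[]] := c1.
(* The segment proper to the new cycle avoids the shared [rev g], so it is shorter than r. *)
have sub : {subset g' <= rcons e1 h}.
  move=> k kg; have : k \in rev g ++ rcons e1 h by rewrite E1 !mem_cat kg !orbT.
  rewrite mem_cat => /orP[kg'|//]; exfalso.
  have : k \in rev g ++ rev (b :: p) by rewrite mem_cat kg'.
  rewrite E2 !mem_cat (negbTE (dj _ kg)) /=.
  move: U1; rewrite cat_uniq => /and3P[_ /hasPn/(_ k)].
  rewrite mem_cat kg => /(_ isT)/= /negbTE ->.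
  by rewrite cat_uniq => /and3P[_ /hasPn/(_ k) + _] /= => /[swap] kb /(_ kb)/=; rewrite kg.
have ug' : uniq g' by move: U1; rewrite !cat_uniq => /and3P[_ _ /andP[]].
have sg' := uniq_leq_size ug' sub; rewrite size_rcons in sg'.
apply: (@IHr (size g')); first by alia.
rewrite E1 in c1 s1; rewrite E2 in c2.
apply: (split_intertwined c1 c2) => //.
by move: s1; rewrite !size_cat; alia.
Qed.

End Intertwined.

Lemma no_intertwined r : ~ intertwined r.
Proof.
have [m] := ubnP r; elim: m r => // m IH r lr [v [s [g [e [cg ce s1 s2 [sg se r0 disj]]]]]].
case: s cg ce s1 s2 => [|a [|b p]] //= cg ce _ s2.
apply: (@intertwined_False r v a b p g e) => //; last by alia.
by move=> r' lr'; apply: IH; alia.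
Qed.

(** Distinct cycles would differ in a middle segment, and the common b makes what remains long
    enough for an intertwined pair. *)
Lemma cyc_share2 v a b c d : cyc V v (a :: b :: c) -> cyc V v (a :: b :: d) ->
  size c = N.-1 -> size d = N.-1 -> c = d.
Proof.
move=> cc cd sc sd; apply/eqP; apply/negPn/negP => /eqP ne.
have s1 : size (b :: c) = N by rewrite /= sc; alia.
have s2 : size (b :: d) = N by rewrite /= sd; alia.
have ne' : b :: c <> b :: d by case.
have [s [g [t [e [E1 E2 sge g0 disj]]]]] := share_split cc cd s1 s2 ne'.
apply: (@no_intertwined (size g)); rewrite E1 in cc s1; rewrite E2 in cd.
apply: (split_intertwined cc cd) => //.
case: s E1 E2 {cc cd s1} => [|k s] //; case: g g0 sge disj => // k g _.
case: e => // k' e _ disj [bk _] [bk' _].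
by have := disj b; rewrite {1}bk bk' !mem_head => /(_ isT).
Qed.

(** Any common prefix or suffix would make the pair intertwined, so the disjoint middle segments are
    all of [c] and [d]. *)
Lemma cyc_share1 w c d i : cyc V w (rcons c i) -> cyc V w (rcons d i) ->
  size c = N -> size d = N -> c <> d -> forall h, h \in c -> h \notin d.
Proof.
move=> cc cd sc sd ne.
have [s [g [t [e [E1 E2 sge g0 disj]]]]] := share_split (cyc_rotr1 cc) (cyc_rotr1 cd) sc sd ne.
have [ab|ab] := posnP (size s + size t).
  have [/size0nil sn /size0nil tn] : size s = 0 /\ size t = 0 by alia.
  by move: E1 E2; rewrite sn tn !cats0 /= => -> ->.
exfalso; apply: (@no_intertwined (size g)).
rewrite E1 in cc sc; rewrite E2 in cd.
exact: (split_intertwined (cyc_rotr1 cc) (cyc_rotr1 cd)).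
Qed.

End Girth.

(** * The edges of one class *)

Section Half.
Variable I : finType.
Notation cube := {ffun I -> bool}.
Implicit Types (x y z u v w a : cube) (s t c d : seq I) (i k h : I) (V W : {set cube}).

Definition side V i (b : bool) : {set cube} := [set x in V | x i == b].

Lemma in_half V i b x : (x \in side V i b) = (x \in V) && (x i == b).
Proof. by rewrite inE. Qed.

Lemma step_ne x k i : k != i -> step x k i = x i.
Proof. by move=> ki; rewrite stepE eq_sym (negbTE ki) addbF. Qed.

Lemma side_step V i x k : x \in V -> step x k \in V -> k != i -> step x k \in side V i (x i).
Proof. by move=> xV kV ki; rewrite in_half kV step_ne ?eqxx. Qed.

Lemma cyc_mono V W x s : V \subset W -> cyc V x s -> cyc W x s.
Proof. by move=> /subsetP VW [us c]; split=> // j; have [h1 h2] := c j; split; apply: VW. Qed.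

Lemma side_sub V i b : side V i b \subset V.
Proof. by apply/subsetP => x; rewrite in_half => /andP[]. Qed.

Lemma side_wg V i b : well_graded V -> well_graded (side V i b).
Proof.
move=> wg x y; rewrite !in_half => /andP[xV /eqP xi] /andP[yV /eqP yi] xy.
have [k kxy kV] := wg _ _ xV yV xy; exists k => //.
rewrite -xi; apply: side_step => //.
by apply: contra_neq kxy => ->; rewrite xi yi.
Qed.

Lemma oncyc_in V x s u : cyc V x s -> oncyc x s u -> u \in V.
Proof. by case=> _ c [j [] ->]; have [] := c j. Qed.

Lemma side_cc V i b x s : ccyc (side V i b) x s -> ccyc V x s.
Proof.
case=> c s1 conv; split=> //; first by apply: cyc_mono c; apply: side_sub.
move=> u v z ou ov zV buv; apply: (conv u v) => //; rewrite in_half zV /=.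
move: (oncyc_in c ou) (oncyc_in c ov); rewrite !in_half => /andP[_ /eqP ui] /andP[_ /eqP vi].
by rewrite buv ui ?vi.
Qed.

Lemma geo_behead V x k s : geo V x (k :: s) -> geo V (step x k) s.
Proof. by move/(geo_drop 1); rewrite /= ?take0 flip1 drop0. Qed.

Lemma geo_step1 V x k s : geo V x (k :: s) -> step x k \in V.
Proof. by move/geo_behead/geo_mem. Qed.

(* The edge of class i at z leads towards a *)
Definition dn V z a i := (z i != a i) && (step z i \in V).

(** All [N.+1] classes of the cycle separate [z] from [a], so the vertex opposite to [z] lies
    between [z] and [a]. *)
Definition branching V N := forall z a, z \in V -> a \in V -> forall i k, i != k ->
  dn V z a i -> dn V z a k ->
  exists s, [/\ cyc V z (i :: rcons s k), size s = N.-1 & forall l, l \in s -> z l != a l].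

End Half.

Section Branching.
Variable I : finType.
Notation cube := {ffun I -> bool}.
Implicit Types (x y z u v w a : cube) (s t c d : seq I) (i k h : I) (V W : {set cube}).
Variable N : nat.
Hypothesis N3 : 2 < N.

Section FirstStep.
Variable V : {set cube}.
Hypotheses (wgV : well_graded V) (ccV : forall x s, ccyc V x s -> size s = N.+1).
Hypothesis brV : branching V N.

(* Otherwise h and k start a second descending cycle at step z i, and its first edge k again has
   two continuations: an infinite descent towards a *)
Lemma first_step z a i k s h : a \in V -> cyc V z (i :: k :: s) -> size s = N.-1 ->
  (forall l, l \in i :: k :: s -> z l != a l) -> dn V (step z i) a h -> h = k.
Proof.
move=> aV; have [m] := ubnP (ham z a); elim: m z i k s h => // m IH z i k s h le cz ss down dh.
apply/eqP; apply/negPn/negP => hk.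
have [/andP[iks /andP[ks us]] cV] := cz.
have ik : i != k by move: iks; rewrite inE negb_or => /andP[].
have zi : z i != a i by apply: down; rewrite mem_head.
have zk : z k != a k by apply: down; rewrite inE mem_head orbT.
have gz := cyc_geo cz.
have z1V := geo_step1 gz; have z1k := geo_step1 (geo_behead gz).
have dk : dn V (step z i) a k by rewrite /dn z1k step_ne ?zk.
have kh : k != h by rewrite eq_sym.
have [[|k2 t] [ct st dt]] := brV z1V aV kh dk dh; first by move: st => /=; alia.
case: s ss us cz ks iks cV down gz => [|i3 s] ss us cz ks iks cV down gz; first by move: ss => /=; alia.
have z13 := geo_step1 (geo_behead (geo_behead gz)).
have [ii3 ki3] : i != i3 /\ k != i3.
  by move: iks ks; rewrite !inE !negb_or => /and3P[_ -> _] /andP[->].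
have d3 : dn V (step (step z i) k) a i3.
  by rewrite /dn z13 !step_ne // down // !inE eqxx !orbT.
have ht : i3 = k2.
  apply: (IH (step z i) k k2 (rcons t h)) d3 => //.
  - by have := ham_flip1 zi; alia.
  - by rewrite size_rcons; move: st => /=.
  move=> l; rewrite inE => /orP[/eqP ->|]; first by case/andP: dk.
  rewrite inE mem_rcons inE orbCA => /orP[/eqP ->|lt]; first by case/andP: dh.
  by apply: dt; rewrite inE.
have c1 := cyc_rot1 cz; rewrite /= ht in c1.
(* Two shared edges identify the cycles, so their last classes agree and h = i; but class i was just
   crossed and no longer leads towards [a]. *)
have := @cyc_share2 _ V N wgV ccV N3 _ _ _ _ _ ct c1.
rewrite !size_rcons; move: st ss => /= -> -> => /(_ erefl erefl) /rcons_inj[_ hi].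
case/andP: dh; rewrite hi stepE eqxx addbT.
by move: zi; case: (z i); case: (a i).
Qed.

End FirstStep.

(** * The forest formed by the edges of one class *)

Section Zone.
Variables (V : {set cube}) (i : I).
Hypotheses (wgV : well_graded V) (ccV : forall x s, ccyc V x s -> size s = N.+1).
Hypothesis brV : forall b, branching (side V i b) N.

Let side_ccV b x s : ccyc (side V i b) x s -> size s = N.+1.
Proof. by move/side_cc/ccV. Qed.

(** A second descending edge h would span with k a cycle inside the side of i. By [first_step] it
    continues along k', so it shares two edges with the given cycle, which leaves that side. *)
Lemma no_branch z a k k' s h : cyc V z (rcons (k :: k' :: s) i) -> size s = N.-2 ->
  a \in side V i (z i) -> dn (side V i (z i)) z a k ->
  dn (side V i (z i)) (step z k) a k' -> dn (side V i (z i)) z a h -> h = k.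
Proof.
move=> cz ss aH dk dk' dh; apply/eqP; apply/negPn/negP => hk.
have zH : z \in side V i (z i) by rewrite in_half eqxx (cyc_mem cz).
have kh : k != h by rewrite eq_sym.
have [[|k0 t] [ct st dt]] := brV zH aH kh dk dh; first by move: st => /=; alia.
have e : k' = k0.
  apply: (first_step (side_wg wgV) (@side_ccV _) (@brV _) aH ct) dk' => //.
    by rewrite size_rcons; move: st => /=.
  move=> l; rewrite inE => /orP[/eqP ->|]; first by case/andP: dk.
  rewrite inE mem_rcons inE orbCA => /orP[/eqP ->|lt]; first by case/andP: dh.
  by apply: dt; rewrite inE.
have c1 := cyc_mono (side_sub V i (z i)) ct; rewrite -e in c1.
have := @cyc_share2 _ V N wgV ccV N3 _ _ _ _ _ c1 cz.
rewrite !size_rcons ss; move: st => /= ->.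
have -> : N.-2.+1 = N.-1 by alia.
move=> /(_ erefl erefl) /rcons_inj[_ hi].
case/andP: dh aH; rewrite hi => zi _; rewrite in_half => /andP[_ /eqP ai].
by rewrite ai eqxx in zi.
Qed.

(** The zone graph of class i: edges of the class at distance [N] are those opposite on a convex
    cycle. *)
Definition zone_rel : rel cube := fun x y =>
  [&& x \in V, step x i \in V, y \in V, step y i \in V, x i == y i & ham x y == N].

Lemma zone_relP x y : reflect (mates V i x y /\ ham x y = N) (zone_rel x y).
Proof.
apply: (iffP and5P) => [[h1 h2 h3 h4 /andP[/eqP h5 /eqP h6]]|[[h1 h2 h3 h4 h5] h6]]; split=> //.
by rewrite h5 h6 !eqxx.
Qed.

Lemma zone_relC : symmetric zone_rel.
Proof.
by move=> x y; apply/zone_relP/zone_relP => -[m h]; split; rewrite 1?hamC //; apply: matesC.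
Qed.

(** Consider a closest pair of edges not joined by a chain. An edge splitting their ladder fails to
    be joined to one of them, so that half is bad again; hence the ladder is a convex cycle and the
    pair is adjacent. *)
Lemma zone_connected x y : mates V i x y -> connect zone_rel x y.
Proof.
have [m] := ubnP (ham x y); elim: m x y => // m IH x y le mxy.
apply/negPn/negP => nc.
have xy : x != y by apply: contra nc => /eqP ->; apply: connect0.
suff e : ham x y = N by case/negP: nc; apply/connect1/zone_relP.
pose bad u v := [/\ mates V i u v, ham u v = ham x y & ~~ connect zone_rel u v].
apply: (@ladder_N _ V N wgV ccV i (ham x y) bad x y) => //.
- by move=> u v [].
- by move=> u v [].
- move=> u v [h1 h2 h3]; split; [exact: matesC | by rewrite hamC |].
  by rewrite (sym_connect_sym zone_relC).
move=> u v w [muv huv nuv] muw l1 l2.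
have near : forall p q, mates V i p q -> ham p q <= ham x y -> ~~ connect zone_rel p q -> bad p q.
  move=> p q mpq l npq; split=> //; apply/eqP; rewrite eqn_leq l leqNgt.
  by apply: contra npq => l'; apply: IH mpq; alia.
case: (boolP (connect zone_rel u w)) => cuw; last by left; apply: near.
right; apply: near l2 _; first exact: (mates_trans muw muv).
by apply: contra nuv; apply: connect_trans.
Qed.

Lemma mates_geo x y : mates V i x y -> ham x y = N ->
  exists c, [/\ geo V x c, flip x c = y, size c = N & cyc V x (rcons c i)].
Proof.
move=> m h; have [xV _ yV _ _] := m; have [c gc ec] := geo_ex wgV xV yV.
exists c; split=> //; first by rewrite -h -ec ham_flip // (proj1 gc).
exact: (mate_cyc wgV ccV N3 m h gc ec).
Qed.

Lemma geo_down x y a s : geo V x s -> flip x s = y -> btw x y a -> forall k, k \in s -> x k != a k.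
Proof.
move=> gs es b k ks; apply: (btw_dif b); rewrite -es flipE ks.
by case: (x k).
Qed.

Lemma geo_head x k s a : geo V x (k :: s) -> x i = a i -> (forall l, l \in k :: s -> x l != a l) ->
  dn (side V i (x i)) x a k.
Proof.
move=> [us gs] xa down; have hk : x k != a k by apply: down; rewrite mem_head.
rewrite /dn hk side_step //; first by have := gs 0; rewrite take0 flip0.
  exact: geo_step1 (conj us gs).
by apply: contra_neq hk => ->.
Qed.

Lemma geo_head2 x k k' s a : geo V x (k :: k' :: s) -> x i = a i ->
  (forall l, l \in k :: k' :: s -> x l != a l) -> dn (side V i (x i)) (step x k) a k'.
Proof.
move=> gs xa down; have hk : x k != a k by apply: down; rewrite mem_head.
have ki : k != i by apply: contra_neq hk => ->.
have e : step x k i = x i by rewrite step_ne.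
rewrite -e; apply: (geo_head (geo_behead gs)); first by rewrite e.
move=> l ls; have [/andP[ks _] _] := gs.
rewrite stepE; have [lk|lk] := eqVneq l k; first by rewrite -lk ls in ks.
by rewrite addbF down // inE ls orbT.
Qed.

Lemma mates_side x s y : flip x s = y -> x i = y i -> i \notin s.
Proof. by move=> <-; rewrite flipE; case: (x i); case: (i \in s). Qed.

(* If the first and the last cycle of a chain share a class, the first such class h on the way
   from xm to xk bounds a ladder inside one side of i, where [branching] is available; the cycle
   it yields shares two edges with a cycle of the chain, yet stays on that side *)
Lemma chain_ends x x1 x2 xm xk : zone_rel x x1 -> zone_rel x1 x2 -> zone_rel xm xk ->
  x1 i = xm i -> btw x x1 xm -> btw x1 xm xk -> btw x1 x2 xm ->
  forall k, x k != x1 k -> xm k = xk k.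
Proof.
move=> /zone_relP[m1 h1] /zone_relP[m2 h2] /zone_relP[m3 h3] x1m b1 b2 b3 l xl.
apply/eqP; apply/negPn/negP => ml.
have [c [gc ec sc cc]] := mates_geo m1 h1; have [d [gd ed sd _]] := mates_geo m3 h3.
have x1i : x i = x1 i by case: m1.
have xmi : xm i = xk i by case: m3.
have hasd : has (fun k => k \in c) d.
  apply/hasP; exists l.
    by move: ml; rewrite -ed flipE; case: (xm l); case: (l \in d).
  by move: xl; rewrite -ec flipE; case: (x l); case: (l \in c).
case/split_find: hasd gd ed sd => h d1 d2 hc d1c gd ed _.
have {}d1c k : k \in d1 -> k \notin c by move=> kd; apply/negP => kc; case/hasP: d1c; exists k.
have ic : i \notin c by apply: mates_side ec _.
have id : i \notin rcons d1 h ++ d2 by apply: mates_side ed _.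
have gd1 : geo V xm (rcons d1 h).
  by have := geo_take (size (rcons d1 h)) gd; rewrite take_size_cat.
have hd1 : h \notin d1 by have [] := gd1; rewrite rcons_uniq => /andP[].
(* Among the classes of the first cycle, [a] differs from [xm] in h only. *)
set a := flip xm (rcons d1 h).
have ai : a i = x i.
  by rewrite /a flipE; move: id; rewrite mem_cat negb_or => /andP[/negbTE -> _]; rewrite addbF x1i x1m.
have cxm k : k \in c -> x k != xm k by apply: geo_down gc ec b1 k.
have cx1 k : k \in c -> x1 k = xm k.
  move=> kc; have := cxm k kc; have : x k != x1 k by rewrite -ec flipE kc; case: (x k).
  by case: (x k); case: (x1 k); case: (xm k).
have ca k : k \in c -> k != h -> a k = xm k.
  move=> kc kh; rewrite /a flipE mem_rcons inE (negbTE kh) /=.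
  by rewrite (negbTE (contraL (@d1c k) kc)) addbF.
have ah : a h != xm h by rewrite /a flipE mem_rcons mem_head; case: (xm h).
have aH : a \in side V i (x i) by rewrite in_half ai eqxx andbT /a; apply: geo_end gd1.
have {d2 gd ed id} dx1a k : xm k != x1 k -> a k = xm k.
  move=> kx; rewrite /a flipE; case: (boolP (k \in rcons d1 h)); last by rewrite addbF.
  move=> kd; have /b2 : x1 k = xk k; last by move=> e; rewrite e eqxx in kx.
  move: kx; rewrite -ed flipE mem_cat kd /=; by case: (xm k); case: (x1 k).
case/splitPr: hc gc ec sc cc ic cxm cx1 ca => u t gc ec sc cc ic cxm cx1 ca.
have hu : h \notin u.
  by have [+ _] := gc; rewrite cat_uniq => /and3P[_ /hasPn/(_ h) + _]; rewrite mem_head => /(_ isT).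
have gu : geo V x u by have := geo_take (size u) gc; rewrite take_size_cat.
have guh : geo V x (rcons u h).
  by have := geo_take (size (rcons u h)) gc; rewrite -cat_rcons take_size_cat.
(* [z] comes right after h on the way from [x] to [x1]. Back across h leads towards [a], and so does
   the next class on the way, as it still separates [z] from [xm]. *)
set z := flip x (rcons u h).
have zh : step z h = flip x u by rewrite /z -cats1 flip_cat ?cats1 ?(proj1 guh) // flip1 stepK.
have hch : h \in u ++ h :: t by rewrite mem_cat mem_head orbT.
have zi : z i = x i.
  rewrite /z flipE; move: ic; rewrite -cat_rcons mem_cat negb_or => /andP[/negbTE -> _].
  by rewrite addbF.
have hi : h != i by apply: contraNneq ic => <-.
have zah : z h != a h.
  have -> : z h = xm h.
    have := cxm h hch; rewrite /z flipE mem_rcons mem_head.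
    by case: (x h); case: (xm h).
  by rewrite eq_sym.
have zH : z \in side V i (x i) by rewrite in_half zi eqxx andbT; apply: geo_end guh.
have dh : dn (side V i (x i)) z a h.
  by rewrite /dn zah -zi side_step ?zh //; [apply: geo_end guh | apply: geo_end gu].
(* If h ends the first cycle, the next class is taken from the cycle joining [x1] to [x2];
   [no_branch] identifies it with h, although [x1] and [xm] agree at h. *)
case: t gc ec sc cc ic cxm cx1 ca hch => [|s t] gc ec sc cc ic cxm cx1 ca hch.
  have zx1 : z = x1 by rewrite -ec /z cats1.
  have [c2 [gc2 ec2 sc2 cc2]] := mates_geo m2 h2.
  case: c2 gc2 ec2 sc2 cc2 => [|s [|s2 r]] gc2 ec2 sc2 cc2; try by move: sc2 => /=; alia.
  have down k : k \in [:: s, s2 & r] -> x1 k != a k.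
    move=> ks; have kx := geo_down gc2 ec2 b3 ks; rewrite dx1a //.
    by rewrite eq_sym.
  have x1a : x1 i = a i by rewrite ai -x1i.
  have sr : size r = N.-2 by move: sc2 => /= <-.
  have aH' : a \in side V i (x1 i) by rewrite -x1i.
  have dh' : dn (side V i (x1 i)) x1 a h by rewrite -x1i -zx1.
  have hs := no_branch cc2 sr aH' (geo_head gc2 x1a down) (geo_head2 gc2 x1a down) dh'.
  have := down s; rewrite mem_head dx1a -?hs => [/(_ isT)|]; first by rewrite cx1 ?eqxx.
  by rewrite eq_sym hs; apply: (geo_down gc2 ec2 b3); rewrite mem_head.
have sch : s \in u ++ [:: h, s & t] by rewrite mem_cat !inE eqxx !orbT.
have [su sh] : s \notin u /\ s != h.
  have [+ _] := gc; rewrite cat_uniq => /and3P[_ /hasPn/(_ s) + /andP[+ _]].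
  rewrite !inE eqxx orbT => /(_ isT) su; rewrite negb_or eq_sym => /andP[sh _].
  by [].
have ds : dn (side V i (x i)) z a s.
  have zs : z s = x s by rewrite /z flipE mem_rcons inE (negbTE sh) (negbTE su) addbF.
  rewrite /dn zs ca // cxm //= -zi side_step //; first exact: geo_end guh.
    have := geo_drop (size (rcons u h)) gc; rewrite -cat_rcons take_size_cat // drop_size_cat //.
    exact: geo_step1.
  by apply: contraNneq ic => <-.
have [k [ck sk dk]] := brV zH aH sh ds dh.
have ck' : cyc V (flip x u) (h :: s :: k).
  by rewrite -zh; apply: cyc_rotr1; apply: cyc_mono ck; apply: side_sub.
have c1 : cyc V (flip x u) (h :: s :: (rcons t i ++ u)).
  by move: cc; rewrite rcons_cat => /cyc_rot.
have e := cyc_share2 wgV ccV N3 ck' c1 sk.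
have := dk i; rewrite e ?zi ?ai ?eqxx; first by rewrite mem_cat mem_rcons mem_head => /(_ isT).
by move: sc; rewrite !size_cat size_rcons /=; alia.
Qed.

(** Induction applies to the chain without its first link, without its last, and without both.
    Lengths add up once the parts before and after [xm] cross no common class, which is
    [chain_ends]. In particular a simple chain never closes up. *)
Lemma zone_chain x p : path zone_rel x p -> uniq (x :: p) -> ham x (last x p) = size p * N.
Proof.
have [m] := ubnP (size p); elim: m x p => // m IH x [|x1 p]; first by rewrite /= ham0.
case/lastP: p => [|q xk] le.
  by rewrite /= andbT => /zone_relP[_ ->] _; rewrite mul1n.
move=> pp up; have xn : x \notin rcons (x1 :: q) xk by case/andP: up.
have un : uniq (rcons (x1 :: q) xk) by case/andP: up.
move: pp {up}; rewrite -rcons_cons last_rcons rcons_path size_rcons => /andP[/= /andP[r1 pq] r3].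
set xm := last x1 q in r3.
have lq : (size q).+1 < m by move: le; rewrite /= size_rcons; alia.
have h1 := IH x (x1 :: q); have h2 := IH x1 (rcons q xk); have h3 := IH x1 q.
have uq : uniq (x1 :: q) by move: un; rewrite rcons_uniq => /andP[].
have xq : x \notin x1 :: q by apply: contra xn => h; rewrite mem_rcons inE h orbT.
have xxk : x != xk by apply: contraNneq xn => ->; rewrite mem_rcons mem_head.
have {}h1 : ham x xm = (size q).+1 * N by apply: h1; rewrite /= ?lq ?r1 ?pq ?xq.
have {}h2 : ham x1 xk = (size q).+1 * N.
  by move: h2; rewrite last_rcons size_rcons rcons_path pq; apply=> //; alia.
have {}h3 : ham x1 xm = size q * N by apply: h3 => //; alia.
have /zone_relP[m1 e1] := r1; have /zone_relP[m3 e3] := r3.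
case: q {xn un} le pq lq @xm r3 m3 e3 uq xq h1 h2 h3 => [|x2 q] le pq lq xm r3 m3 e3 uq xq h1 h2 h3.
  (* Two links: their cycles share the edge at [x1], so [cyc_share1] makes their classes
     disjoint. *)
  rewrite /xm /= in m3 e3.
  have [c [gc ec sc cc]] := mates_geo (matesC m1) (etrans (hamC _ _) e1).
  have [d [gd ed sd cd]] := mates_geo m3 e3.
  have ne : c <> d by move=> e; move: xxk; rewrite -ec -ed e eqxx.
  have disj := cyc_share1 wgV ccV N3 cc cd sc sd ne.
  rewrite -ec -ed ham_flips_disj ?sc ?sd /=; first by rewrite mul2n addnn.
  rewrite cat_uniq (proj1 gc) (proj1 gd) andbT; apply/hasPn => k kd.
  by apply/negP => /disj; rewrite kd.
have x2m : ham x2 xm = size q * N.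
  move: pq uq => /= /andP[_ pq] /andP[_ uq]; apply: IH => //.
  by move: lq => /=; alia.
move: pq => /= /andP[r2 pq]; have /zone_relP[m2 e2] := r2.
have b1 : btw x x1 xm by apply/ham_btw; rewrite h1 h3 e1 mulSn.
have b2 : btw x1 xm xk by apply/ham_btw; rewrite h2 h3 e3 mulSn addnC.
have b3 : btw x1 x2 xm by apply/ham_btw; rewrite h3 x2m e2 mulSn.
have sd : x1 i = xm i.
  rewrite /xm /=; move: (m2) => [_ _ _ _ ->]; elim: (q) (x2) pq => //= y q' IHq x' /andP[].
  by move=> /zone_relP[[_ _ _ _ ->] _] /IHq.
have ends := chain_ends r1 r2 r3 sd b1 b2 b3.
suff b : btw x xm xk by have := proj1 (ham_btw _ _ _) b; rewrite h1 e3 => <-; rewrite [in RHS]mulSn addnC.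
move=> k xk'; have [e|ne] := eqVneq (x k) (x1 k); last by rewrite (ends k ne).
by rewrite e; apply: b2; rewrite -e.
Qed.

End Zone.

Lemma card_side V i b x y : x \in V -> y \in V -> x i != y i -> #|side V i b| < #|V|.
Proof.
move=> xV yV xy; apply: proper_card; rewrite properE side_sub; apply/subsetPn.
have [xb|xb] := eqVneq (x i) b; last by exists x; rewrite ?in_half ?xV.
by exists y; rewrite // in_half yV -xb eq_sym.
Qed.

(* Induction on the size of V, because [zone_chain] needs branching on both sides of i *)
Theorem branchingP V : well_graded V -> (forall x s, ccyc V x s -> size s = N.+1) -> branching V N.
Proof.
have [m] := ubnP #|V|; elim: m V => // m IH V le wgV ccV z a zV aV i j ij /andP[zai ziV] /andP[zaj zjV].
have brV b : branching (side V i b) N.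
  apply: IH; [|exact: side_wg|by move=> x s /side_cc/ccV].
  have zz : z i != step z i i by rewrite stepE eqxx; case: (z i).
  by have := card_side b zV ziV zz; alia.
have ji : j != i by rewrite eq_sym.
have uai : step z j i != a i by rewrite step_ne.
have bu : btw (step z j) a a by [].
(* Cross j first and then follow a geodesic to [a] until it crosses i: [w] lies between [z] and [a],
   and j separates it from [z]. *)
have [w [wV wiV wi ew _]] := @cross _ V i _ a a wgV zjV aV aV bu uai.
rewrite step_ne // in wi.
have b1 : btw (step z j) w a.
  apply/ham_btw; have := ham_tri w (step z j) a; have := ham_tri (step w i) w a.
  by rewrite ham_step; alia.
have bj : btw z (step z j) a.
  by move=> k e; rewrite step_ne //; apply: contra_neq zaj => ->; rewrite e.
have b2 : btw z w a by apply: (btw_hull bj _ b1).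
have wj : w j = a j.
  have e : step z j j = a j by rewrite stepE eqxx; move: zaj; case: (z j); case: (a j).
  by rewrite b1.
have mzw : mates V i z w by split.
have zw : z != w by apply: contra_neq zaj => ->.
(* The simple chain from [z] to [w] is a geodesic, so its first link descends towards [w]. So does
   j, and [no_branch] makes j the first class of that link, whose cycle is the one wanted. *)
have /connectP[p pp lp] := zone_connected wgV ccV mzw.
case: (shortenP pp) lp => {pp} -[|x1 p'] pp up _ lp; first by rewrite lp eqxx in zw.
have hzw := zone_chain wgV ccV brV pp up.
move: pp (up) => /= /andP[/zone_relP[m1 h1] pp] /andP[_ up'].
have hx1 := zone_chain wgV ccV brV pp up'.
have b3 : btw z x1 w by apply/ham_btw; rewrite lp /= hx1 h1 hzw /= mulSn.
have b4 := btw_trans b2 b3.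
have [c [gc ec sc cc]] := mates_geo wgV ccV m1 h1.
case: c gc ec sc cc => [|s [|s2 r]] gc ec sc cc; try by move: sc => /=; alia.
have down k : k \in [:: s, s2 & r] -> z k != w k by apply: geo_down gc ec b3 k.
have sr : size r = N.-2 by move: sc => /= <-.
have wH : w \in side V i (z i) by rewrite in_half wV wi eqxx.
have dj : dn (side V i (z i)) z w j by rewrite /dn wj zaj side_step.
have ezw : z i = w i by rewrite wi.
have js := no_branch wgV ccV brV cc sr wH (geo_head gc ezw down) (geo_head2 gc ezw down) dj.
exists (rev (s2 :: r)); split.
- by have := cyc_rev cc; rewrite rev_rcons rev_cons js.
- by rewrite size_rev /= sr; alia.
move=> l; rewrite mem_rev => ls; apply: (btw_dif b2); apply: down.
by rewrite inE ls orbT.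
Qed.

End Branching.

(** * A minimal side of a class *)

Section MinimalHalf.
Variable I : finType.
Notation cube := {ffun I -> bool}.
Implicit Types (x y z u v w a c : cube) (s t : seq I) (i k h f : I) (b : bool).
Variables (V : {set cube}) (N : nat).
Hypotheses (wgV : well_graded V) (ccV : forall x s, ccyc V x s -> size s = N.+1).
Hypothesis N3 : 2 < N.

Definition nbr x : {set I} := [set i | step x i \in V].

Definition cut (fb : I * bool) : bool :=
  (side V fb.1 fb.2 != set0) && (side V fb.1 (~~ fb.2) != set0).

Definition minimal_cut f b : Prop :=
  cut (f, b) /\ forall k b', cut (k, b') -> #|side V f b| <= #|side V k b'|.

Let brV : branching V N. Proof. exact: branchingP. Qed.

Lemma minimal_cut_ex : (exists2 x, x \in V & nbr x != set0) -> exists f b, minimal_cut f b.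
Proof.
case=> x xV /set0Pn[i]; rewrite inE => iV.
have c0 : cut (i, x i).
  apply/andP; split; apply/set0Pn; first by exists x; rewrite in_half xV eqxx.
  by exists (step x i); rewrite in_half iV stepE eqxx addbT eqxx.
case: (arg_minnP (fun fb => #|side V fb.1 fb.2|) c0) => -[f b] cfb min.
by exists f, b; split=> // k b'; apply: min.
Qed.

Lemma cut_edge f b : cut (f, b) -> exists c, [/\ c \in V, c f = b & step c f \in V].
Proof.
case/andP=> /set0Pn[/= x]; rewrite in_half => /andP[xV /eqP xf] /set0Pn[y].
rewrite in_half => /andP[yV /eqP yf].
have bx : btw x x y by [].
have xy : x f != y f by rewrite xf yf; case: (b).
have [w [wV wfV wf _ _]] := cross wgV xV xV yV bx xy.
by exists w; split=> //; rewrite wf.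
Qed.

(* Minimality: the far side of the edge c - step c k is not contained in the minimal side *)
Lemma minimal_cut_cyc f b c k : minimal_cut f b -> c \in V -> c f = b -> step c f \in V ->
  k != f -> step c k \in V -> exists s, cyc V c (k :: rcons s f) /\ size s = N.-1.
Proof.
move=> [_ min] cV cf cfV kf ckV.
have sk : step c k k = ~~ c k by rewrite stepE eqxx addbT.
have ck : cut (k, ~~ c k).
  apply/andP; split; apply/set0Pn; first by exists (step c k); rewrite in_half ckV sk eqxx.
  by exists c; rewrite in_half cV negbK eqxx.
have /subsetPn[q qk qf] : ~~ (side V k (~~ c k) \subset side V f b).
  apply/negP => sub; have := min _ _ ck; rewrite leqNgt => /negP[].
  apply: proper_card; rewrite properE sub; apply/subsetPn; exists c.
    by rewrite in_half cV cf eqxx.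
  by rewrite in_half; case: (c k); rewrite andbF.
move: qk qf; rewrite !in_half => /andP[qV /eqP qk]; rewrite qV /= => qf.
(* A geodesic from [step c k] to [q] crosses f at some [w]; then both k and f lead from [c] towards
   [step w f]. *)
have bq : btw (step c k) q q by [].
have uq : step c k f != q f by rewrite step_ne // cf eq_sym.
have [w [wV wfV wf ew _]] := cross wgV ckV qV qV bq uq.
rewrite step_ne // in wf.
have bw : btw (step c k) w q.
  apply/ham_btw; have := ham_tri w (step c k) q; have := ham_tri (step w f) w q.
  by rewrite ham_step; alia.
have wk : w k = ~~ c k by rewrite bw sk.
have dk : dn V c (step w f) k by rewrite /dn ckV andbT step_ne 1?eq_sym // wk; case: (c k).
have df : dn V c (step w f) f by rewrite /dn cfV andbT stepE eqxx wf; case: (c f).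
by have [s [cs ss _]] := brV cV wfV kf dk df; exists s.
Qed.

Lemma degree2_ccyc : V != set0 -> (forall x, x \in V -> 1 < #|nbr x|) ->
  exists x s, ccyc V x s.
Proof.
case/set0Pn=> x xV deg.
have [|f [b m]] := minimal_cut_ex.
  by exists x => //; rewrite -card_gt0; apply: ltnW (deg x xV).
have [c [cV cf cfV]] := cut_edge (proj1 m).
have /set0Pn[k] : nbr c :\ f != set0.
  have d := deg c cV; have e := cardsD1 f (nbr c); rewrite inE cfV in e.
  by rewrite -card_gt0; alia.
rewrite !inE => /andP[kf kV].
have [s [cs ss]] := minimal_cut_cyc m cV cf cfV kf kV.
exists c, (rcons (k :: s) f); apply: (cyc_convex wgV ccV N3 (s := k :: s) cs).
by rewrite /= ss; alia.
Qed.

(** Towards [step a f] the classes k and f span a cycle, towards [a] the classes k and k' span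
    another. By [first_step] they agree in a second edge, hence coincide, and then k' = f. *)
Lemma unique_down f c a k k' : a \in V -> c \in V -> step c f \in V -> step a f \in V -> c f = a f ->
  dn V c a k -> dn V c a k' -> k = k'.
Proof.
move=> aV cV cfV afV cf dk dk'; apply/eqP; apply/negPn/negP => kk.
have nf h : dn V c a h -> h != f.
  by move=> /andP[hh _]; apply: contra_neq hh => ->.
have dnf h : dn V c a h -> dn V c (step a f) h.
  by move=> dh; rewrite /dn step_ne; [exact: dh | rewrite eq_sym; exact: nf dh].
have df : dn V c (step a f) f by rewrite /dn cfV andbT stepE eqxx cf; case: (a f).
have [[|s0 s] [cs ss ds]] := brV cV afV (nf _ dk) (dnf _ dk) df; first by move: ss => /=; alia.
have [[|t0 t] [ct st dt]] := brV cV aV kk dk dk'; first by move: st => /=; alia.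
have e : t0 = s0.
  apply: (first_step N3 wgV ccV brV afV cs).
  - by rewrite size_rcons; move: ss => /=.
  - move=> l; rewrite inE => /orP[/eqP ->|]; first by case/andP: (dnf _ dk).
    rewrite inE mem_rcons inE orbCA => /orP[/eqP ->|ls]; first by case/andP: df.
    by apply: ds; rewrite inE.
  have [/= /andP[kt _] _] := ct.
  have kt0 : k != t0 by apply: contraNneq kt => ->; rewrite mem_head.
  have ct0 : c t0 != a t0 by apply: dt; rewrite mem_head.
  have t0f : f != t0 by apply: contra_neq ct0 => <-.
  by rewrite /dn (geo_step1 (geo_behead (cyc_geo ct))) !step_ne // ct0.
rewrite e in ct; have := cyc_share2 wgV ccV N3 ct cs.
rewrite !size_rcons; move: ss st => /= -> -> /(_ erefl erefl) /rcons_inj[_ kf].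
by have := nf _ dk'; rewrite kf eqxx.
Qed.

(* At the first class l that leads back towards a, [branching] yields a cycle sharing two edges
   with the given one but staying on one side of f *)
Lemma cyc_up c a k s f : a \in V -> cyc V c (k :: rcons s f) -> size s = N.-1 ->
  c f = a f -> c k = a k -> forall l, l \in k :: s -> c l = a l.
Proof.
move=> aV cc ss cf ck l ls; apply/eqP; apply/negPn/negP => cl.
have hl : has (fun l => c l != a l) s.
  apply/hasP; exists l => //; move: ls; rewrite inE => /orP[/eqP e|//].
  by rewrite e ck eqxx in cl.
case/split_find: hl cc ss => {cl ls}l s1 s2 cl up cc ss.
have [g [s1' e1]] : exists g s', k :: s1 = rcons s' g.
  by exists (last k s1), (belast k s1); apply: lastI.
have E : k :: rcons (rcons s1 l ++ s2) f = s1' ++ g :: l :: rcons s2 f.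
  by rewrite -cat_rcons -e1 cat_rcons rcons_cat.
rewrite E in cc; have [uc _] := cc.
have gc := cyc_geo cc; have gg := geo_drop (size s1') gc.
rewrite take_size_cat // drop_size_cat // in gg.
set v0 := flip c s1' in gg *.
have vV := geo_step1 gg; have vlV := geo_step1 (geo_behead gg).
have v0V := geo_mem gg.
have cg : c g = a g.
  have : g \in k :: s1 by rewrite e1 mem_rcons mem_head.
  rewrite inE => /orP[/eqP -> //|gs].
  by apply/eqP; apply: contraNT up => h; apply/hasP; exists g.
have nin h : h \in [:: g, l & rcons s2 f] -> v0 h = c h.
  move=> hh; move: uc; rewrite cat_uniq => /and3P[_ /hasPn/(_ h hh) hs _].
  by rewrite /v0 flipE (negbTE hs) addbF.
have [/andP[gl _] _] := gg.
have gnl : g != l by apply: contraNneq gl => ->; rewrite mem_head.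
have gnf : g != f by apply: contraNneq gl => ->; rewrite inE mem_rcons mem_head orbT.
have ln : l != g by rewrite eq_sym.
have dg : dn V (step v0 g) a g.
  by rewrite /dn stepK v0V stepE eqxx nin ?mem_head // cg; case: (a g).
have dl : dn V (step v0 g) a l.
  by rewrite /dn vlV step_ne // nin ?cl // !inE eqxx orbT.
have [t [ct st dt]] := brV vV aV ln dl dg.
have c1 := cyc_rotr1 (s := l :: t) ct; rewrite stepK in c1.
have c2 := cyc_rot cc; have := cyc_share2 wgV ccV N3 c1 c2 st.
have sz : size (rcons s2 f ++ s1') = N.-1.
  move: ss (congr1 size e1); rewrite !size_cat !size_rcons /=.
  by alia.
move=> /(_ sz) et.
have := dt f; rewrite et mem_cat mem_rcons mem_head step_ne // nin => [/(_ isT)|].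
  by rewrite cf eqxx.
by rewrite !inE mem_rcons mem_head !orbT.
Qed.

Theorem degree3_False : V != set0 -> (forall x, x \in V -> 2 < #|nbr x|) -> False.
Proof.
case/set0Pn=> x0 x0V deg.
have [|f [b m]] := minimal_cut_ex.
  by exists x0 => //; rewrite -card_gt0; apply: ltnW (ltnW (deg x0 x0V)).
have [c0 [c0V c0f c0fV]] := cut_edge (proj1 m).
pose U : pred (cube * cube) := fun p =>
  [&& p.1 \in V, step p.1 f \in V, p.1 f == b & [&& p.2 \in V, step p.2 f \in V & p.2 f == b]].
have U0 : U (c0, c0) by rewrite /U /= c0V c0fV c0f eqxx.
case: (arg_maxnP (fun p => ham p.1 p.2) U0) => -[a c] /and4P[/= aV afV /eqP af].
case/and3P=> cV cfV /eqP cf max.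
have caf : c f = a f by rewrite cf.
(* Besides f at least two edges leave [c], and by [unique_down] at most one of them leads towards
   [a]. *)
have [k [kf kV ck]] : exists k, [/\ k != f, step c k \in V & c k = a k].
  have card2 : 1 < #|nbr c :\ f|.
    have d := deg c cV; have e := cardsD1 f (nbr c); rewrite inE cfV in e.
    by alia.
  have /card_gt1P[k1 [k2 [n1 n2 n12]]] := card2.
  move: n1 n2; rewrite !inE => /andP[k1f k1V] /andP[k2f k2V].
  have [e|ne] := eqVneq (c k1) (a k1); first by exists k1.
  have [e|ne2] := eqVneq (c k2) (a k2); first by exists k2.
  have := @unique_down f c a k1 k2 aV cV cfV afV caf; rewrite /dn ne ne2 k1V k2V.
  by move=> /(_ isT isT) e; rewrite e eqxx in n12.
have [s [cs ss]] := minimal_cut_cyc m cV cf cfV kf kV.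
have up := cyc_up aV cs ss caf ck.
have gs := cyc_geo cs; rewrite -rcons_cons in gs.
have [us _] := gs; have ms := cyc_mates (s := k :: s) cs.
have [_ _ c'V c'fV e] := ms.
have := max (a, flip c (k :: s)); rewrite /U /= aV afV af eqxx c'V c'fV -e cf eqxx => /(_ isT).
have bt : btw a c (flip c (k :: s)).
  move=> l; rewrite flipE; case: (boolP (l \in _)) => ls; last by rewrite addbF.
  by rewrite -(up l ls); case: (c l).
have := proj1 (ham_btw _ _ _) bt; rewrite ham_flip; last by move: us; rewrite rcons_uniq => /andP[].
by move=> <-; rewrite /= ss; alia.
Qed.

End MinimalHalf.

(** * Back to graphs *)

Section CyclePoints.
Variable I : finType.
Notation cube := {ffun I -> bool}.
Implicit Types (x y z u v : cube) (s : seq I) (j k : nat) (V : {set cube}).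

(** The vertex number j of the closed walk, for j below [2 * size s]: on the second reading of [s],
    flipping a prefix back leaves a suffix. *)
Definition point x s j : cube :=
  if j < size s then flip x (take j s) else flip x (drop (j - size s) s).

Lemma ham_take x s j k : uniq s -> j <= k -> k <= size s ->
  ham (flip x (take j s)) (flip x (take k s)) = k - j.
Proof.
move=> us jk ks; have uk := take_uniq k us.
rewrite -[X in ham X _](congr1 (flip x) (@take_takel _ j k s jk)) -(flip_take x j uk).
by rewrite ham_flip ?drop_uniq // size_drop size_takel.
Qed.

Lemma ham_take_drop x s j k : uniq s -> j <= k -> k <= size s ->
  ham (flip x (take j s)) (flip x (drop k s)) = j + (size s - k).
Proof.
move=> us jk ks; rewrite ham_flips_disj ?size_drop ?size_takel ?(leq_trans jk) //.
rewrite cat_uniq take_uniq // drop_uniq // andbT; apply/hasPn => i id /=.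
apply/negP; rewrite -(@take_takel _ j k s jk) => /mem_take it.
move: us; rewrite -{1}(cat_take_drop k s) cat_uniq => /and3P[_ /hasPn/(_ i id)].
by rewrite /= it.
Qed.

Lemma ham_point x s j k : uniq s -> j <= k -> k < 2 * size s ->
  ham (point x s j) (point x s k) = minn (k - j) (2 * size s - (k - j)).
Proof.
move=> us jk kl; rewrite /point; case: (ltnP j (size s)) => js; case: (ltnP k (size s)) => ks.
- by rewrite ham_take //; [alia | apply: ltnW].
- case: (leqP j (k - size s)) => h; first by rewrite ham_take_drop //; alia.
  rewrite hamC -(flip_take2 x _ us) -(flip_drop x _ us) ham_take_drop //; alia.
- by alia.
by rewrite -!(flip_take2 x _ us) ham_take //; alia.
Qed.

Lemma point_in V x s j : cyc V x s -> point x s j \in V.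
Proof.
by case=> _ c; rewrite /point; case: ifP => _; [have [] := c j | have [] := c (j - size s)].
Qed.

Lemma oncyc_point x s z : 0 < size s -> oncyc x s z -> exists2 j, j < 2 * size s & z = point x s j.
Proof.
move=> s0 [j [] ->].
  case: (ltnP j (size s)) => h; first by exists j; [alia | rewrite /point h].
  exists (size s); first by alia.
  by rewrite /point ltnn subnn drop0 take_oversize.
case: (ltnP j (size s)) => h.
  by exists (size s + j); [alia | rewrite /point ltnNge leq_addr /= addKn].
exists 0; first by alia.
by rewrite /point s0 take0 drop_oversize.
Qed.

Lemma point_oncyc x s j : oncyc x s (point x s j).
Proof.
by rewrite /point; case: ifP => _; [exists j; left | exists (j - size s); right].
Qed.

End CyclePoints.

Section Graph.
Variables (T : finType) (e : rel T).

Definition connected := forall u v, exists k, walk e u v k.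

Lemma connected_ind (P : T -> Prop) x : connected -> P x ->
  (forall y z, P y -> e y z -> P z) -> forall y, P y.
Proof.
move=> conn Px step y; have [_ [p [_ pp <-]]] := conn x y.
by elim: p x Px pp => //= z p IH x Px /andP[/(step _ _ Px)]; apply: IH.
Qed.

(** A vertex of the cycle already has two neighbours on it, so no edge leaves the cycle. *)
Lemma cycle_covers (c : seq T) : symmetric e -> connected -> (forall v, #|[set w | e v w]| <= 2) ->
  is_cycle e c -> forall x, x \in c.
Proof.
move=> sym conn deg [uc sc cc].
have [x0 x0c] : exists x, x \in c by case: (c) sc => // x *; exists x; rewrite mem_head.
apply: (connected_ind conn x0c) => x y xc xy.
case/rot_to: xc => k c' rc; rewrite -(mem_rot k) rc.
move: uc sc cc; rewrite -(rot_uniq k) -(size_rot k) -(rot_cycle k) rc.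
case: c' {rc} => [|a [|b r]] // uc _ cc; apply/negPn/negP => yc.
have xa : e x a by case/andP: cc.
have xl : e x (last b r) by move: cc; rewrite sym /= rcons_path => /and4P[].
have lb : last b r \in b :: r by apply: mem_last.
have ul : uniq [:: a; last b r; y].
  move: uc yc => /and3P[_ ac _]; rewrite !inE !negb_or => /and4P[_ ya yb yr] /=.
  rewrite !inE negb_or andbT eq_sym [a == y]eq_sym ya andbT; apply/andP; split.
    by apply: contraNneq ac => <-.
  by apply: contraTneq lb => ->; rewrite inE negb_or yb.
have := deg x; rewrite leqNgt => /negP[]; rewrite -[3]/(size [:: a; last b r; y]) -(card_uniqP ul).
by apply: subset_leq_card; apply/subsetP => z; rewrite !inE => /or3P[] /eqP ->.
Qed.

Lemma cover_size (c : seq T) : uniq c -> (forall x, x \in c) -> size c = #|T|.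
Proof. by move=> uc cov; rewrite -(card_uniqP uc); apply: eq_card => x; rewrite cov. Qed.

Lemma next_index (c : seq T) x : uniq c -> x \in c -> index (next c x) c = (index x c).+1 %% size c.
Proof.
move=> uc xc; rewrite next_nth xc; case: c uc xc => // y c uc xc.
have := xc; rewrite -index_mem /= ltnS leq_eqVlt => /orP[/eqP h|h].
  by rewrite h modnn nth_default // eqxx.
rewrite modn_small //; have := @index_uniq _ y (index x (y :: c)).+1 (y :: c).
by rewrite /= ltnS; apply.
Qed.

Lemma edge_cycle_rel (c : seq T) : simple_graph e -> convex_cycle e c -> forall x y, x \in c -> y \in c ->
  e x y = cycle_rel c x y.
Proof.
move=> [sym irr] [[uc sc cc] [_ conv]] x y xc yc; apply/idP/idP => [xy|].
  have xs : x \in [set z in c] by rewrite inE.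
  have ys : y \in [set z in c] by rewrite inE.
  have [|_] := conv x y xs ys [:: y]; last by rewrite /= andbT.
  split; rewrite /= ?xy //; split; first by exists [:: y]; rewrite /= xy.
  by move=> [|//] _ [p [/size0nil -> _ /= exy]]; rewrite exy irr in xy.
rewrite /cycle_rel xc yc /= => /orP[] /eqP ->; first exact: next_cycle.
by rewrite sym; apply: next_cycle.
Qed.

Lemma covering_cycle_isomorphic (c : seq T) : simple_graph e -> convex_cycle e c -> (forall x, x \in c) ->
  isomorphic e (cycle_graph (size c)).
Proof.
move=> sg cvx cov; have uc : uniq c by case: cvx => -[].
have lt x : index x c < size c by rewrite index_mem.
have inj : injective (fun x => Ordinal (lt x)).
  by move=> x y [] exy; rewrite -(nth_index x (cov x)) exy nth_index.
exists (fun x => Ordinal (lt x)); split.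
  by apply: inj_card_bij => //; rewrite card_ord (cover_size uc cov).
move=> x y; rewrite (edge_cycle_rel sg cvx) // /cycle_rel !cov /cycle_graph /=.
by rewrite -!next_index //; congr orb; apply/eqP/eqP => [/index_inj|->//]; apply.
Qed.

End Graph.

Lemma ham1_step (I : finType) (x y : {ffun I -> bool}) : ham x y = 1 -> exists i, y = step x i.
Proof.
move/eqP/cards1P=> [i E]; exists i; apply/ffunP => k; rewrite stepE.
by move/setP/(_ k): E; rewrite !inE; case: (x k); case: (y k); case: (k == i).
Qed.

Lemma walk_ham (T : finType) (e : rel T) (I : finType) (f : T -> {ffun I -> bool}) u v k :
  (forall u v, e u v -> ham (f u) (f v) = 1) -> walk e u v k -> ham (f u) (f v) <= k.
Proof.
move=> ef [p [<- pp <-]]; elim: p u pp => [|w p IH] u /=; first by rewrite ham0.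
by case/andP=> /ef h /IH l; have := ham_tri (f w) (f u) (f (last w p)); alia.
Qed.

Lemma hypercube_dist m (x y : {ffun 'I_m -> bool}) : dist_is (@hypercube_rel m) x y (ham x y).
Proof.
split; last first.
  move=> j lj /(@walk_ham _ _ _ id) h; have : ham x y <= j by apply: h => u v /eqP.
  by rewrite leqNgt lj.
have [d] := ubnP (ham x y); elim: d x => // d IH x le.
have [->|xy] := eqVneq x y; first by rewrite ham0; exists [::].
have [i xyi] : exists i, x i != y i.
  apply/existsP; apply: contraR xy; rewrite negb_exists => /forallP h.
  by apply/eqP/ffunP => i; have := h i; rewrite negbK => /eqP.
have h1 := ham_flip1 xyi; have [|p [sp pp lp]] := IH (step x i); first by alia.
exists (step x i :: p); split=> //=; first by rewrite sp.
by rewrite pp andbT; apply/eqP; apply: ham_step.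
Qed.

Section Embedding.
Variables (T : finType) (e : rel T) (m : nat) (f : T -> {ffun 'I_m -> bool}).
Hypotheses (sge : simple_graph e) (inj : injective f)
  (edge : forall u v, e u v -> hypercube_rel (f u) (f v))
  (dist : forall u v k, dist_is e u v k <-> dist_is (@hypercube_rel m) (f u) (f v) k).

Lemma edge_ham u v : e u v -> ham (f u) (f v) = 1.
Proof. by move/edge/eqP. Qed.

Lemma dist_ham u v : dist_is e u v (ham (f u) (f v)).
Proof. by apply/dist; apply: hypercube_dist. Qed.

Lemma ham_edge u v : e u v = (ham (f u) (f v) == 1).
Proof.
apply/idP/eqP => [|h]; first exact: edge_ham.
have [[p [sp pp lp]] _] := dist_ham u v.
by case: p sp pp lp => [|w [|]] /=; rewrite h // andbT => _ uw <-.
Qed.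

Lemma embedding_connected : connected e.
Proof. by move=> u v; exists (ham (f u) (f v)); case: (dist_ham u v). Qed.

Definition vertices : {set {ffun 'I_m -> bool}} := [set f u | u : T].

Lemma vertices_f u : f u \in vertices.
Proof. exact: imset_f. Qed.

Lemma vertices_wg : well_graded vertices.
Proof.
move=> x y /imsetP[u _ ->] /imsetP[v _ ->] uv.
have [[[|w p] [sp pp lp]] _] := dist_ham u v.
  by move: sp => /esym/eqP; rewrite ham_eq0 (negbTE uv).
case/andP: pp => uw pp.
have [i wi] := ham1_step (edge_ham uw); exists i; last by rewrite -wi vertices_f.
apply/eqP => ui; have : ham (f w) (f v) <= size p.
  by apply: (walk_ham edge_ham); exists p.
have : step (f u) i i != f v i by rewrite -ui stepE eqxx; case: (f u i).
by move/ham_flip1; rewrite stepK -wi; move: sp => /=; alia.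
Qed.

Lemma degree_le_nbr v : #|[set w | e v w]| <= #|nbr vertices (f v)|.
Proof.
rewrite -(card_imset _ inj); apply: leq_trans (leq_imset_card (step (f v)) _).
apply: subset_leq_card; apply/subsetP => y /imsetP[w]; rewrite inE => vw ->.
have [i wi] := ham1_step (edge_ham vw).
by apply/imsetP; exists i => //; rewrite inE -wi vertices_f.
Qed.

Lemma shortest_btw u v p w : shortest_path e u v p -> w \in p -> btw (f u) (f w) (f v).
Proof.
move=> [pp lp [_ dp]] wp.
have sp : size p = ham (f u) (f v).
  have l1 : ham (f u) (f v) <= size p by apply: (walk_ham edge_ham); exists p.
  apply/eqP; rewrite eqn_leq l1 andbT leqNgt; apply/negP => /dp[].
  by case: (dist_ham u v).
case/path.splitP: wp pp lp sp => p1 p2; rewrite cat_path last_cat last_rcons => /andP[q1 q2] lp sp.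
have l1 : ham (f u) (f w) <= size (rcons p1 w).
  by apply: (walk_ham edge_ham); exists (rcons p1 w); rewrite last_rcons.
have l2 : ham (f w) (f v) <= size p2 by apply: (walk_ham edge_ham); exists p2.
have l3 := ham_tri (f w) (f u) (f v); rewrite size_cat in sp.
by apply/ham_btw; alia.
Qed.

(** Shortest paths between vertices of [c] stay in [c] because their vertices are between the ends,
    and then use only cycle edges. This gives isometry as well as convexity. *)
Lemma convex_cycle_intro c : is_cycle e c ->
  (forall x y, x \in c -> y \in c -> e x y -> cycle_rel c x y) ->
  (forall u v w, u \in c -> v \in c -> btw (f u) (f w) (f v) -> w \in c) -> convex_cycle e c.
Proof.
move=> cyc ind conv; have [uc sc cc] := cyc; have [sym irr] := sge.
have sub u v k : walk (cycle_rel c) u v k -> walk e u v k.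
  case=> p [sp pp lp]; exists p; split=> //; apply: sub_path pp => x y.
  rewrite /cycle_rel => /andP[/andP[xc yc] /orP[] /eqP ->]; first exact: next_cycle.
  by rewrite sym; apply: next_cycle.
have inside u v : u \in c -> v \in c -> forall p, shortest_path e u v p ->
    all (mem [set x in c]) p /\ path (cycle_rel c) u p.
  move=> uc' vc p sp; have pc w : w \in p -> w \in c.
    by move=> wp; apply: (conv u v) => //; apply: shortest_btw sp wp.
  split; first by apply/allP => w wp; rewrite /= inE pc.
  have [pp _ _] := sp; elim: p u uc' pc pp {sp} => //= w p IH u uc' pc /andP[uw pp].
  have wc : w \in c by apply: pc; rewrite mem_head.
  by rewrite ind //=; apply: IH => // z zp; apply: pc; rewrite inE zp orbT.
split=> //; split; last by move=> u v; rewrite !inE; apply: inside.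
move=> u v; rewrite !inE => uc' vc.
have to k : dist_is e u v k -> dist_is (cycle_rel c) u v k.
  move=> d; have [[p [sp pp lp]] dp] := d.
  have [_ pp'] := inside u v uc' vc p (And3 pp lp (eq_ind_r (dist_is e u v) d sp)).
  by split; [exists p | move=> j /dp nj /sub].
move=> k; split; last exact: to.
move=> d; have dh := dist_ham u v; suff -> : k = ham (f u) (f v) by [].
have [w1 d1] := d; have [w2 d2] := to _ dh.
apply/eqP; rewrite eqn_leq; apply/andP; split; rewrite leqNgt; apply/negP.
  by move=> /d1[].
by move=> /d2[].
Qed.

Lemma ccyc_convex_cycle x s : ccyc vertices x s ->
  exists c, [/\ convex_cycle e c, size c = 2 * size s & forall u, u \in c <-> oncyc x s (f u)].
Proof.
case=> cx s1 conv; have [us _] := cx; set L := 2 * size s.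
have L3 : 3 < L by rewrite /L; alia.
have s0 : 0 < size s := ltnW s1.
have [u0 _] : exists u0 : T, true by have /imsetP[u _ _] := cyc_mem cx; exists u.
pose g y := odflt u0 [pick u | f u == y].
have gK y : y \in vertices -> f (g y) = y.
  case/imsetP=> u _ ->; rewrite /g; case: pickP => [v /eqP //|/(_ u)].
  by rewrite eqxx.
pose c := mkseq (fun j => g (point x s j)) L.
have fg j : f (g (point x s j)) = point x s j by apply: gK; apply: point_in.
have inc j : j < L -> g (point x s j) \in c.
  by move=> jL; apply/mapP; exists j; rewrite // mem_iota.
have memc u : u \in c <-> oncyc x s (f u).
  split=> [/mapP[j _ ->]|]; first by rewrite fg; apply: point_oncyc.
  by case/(oncyc_point s0) => j jL E; rewrite (_ : u = g (point x s j)) ?inc //; apply: inj; rewrite E fg.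
have cP u : u \in c -> exists2 j, j < L & u = g (point x s j).
  by case/mapP=> j; rewrite mem_iota => /andP[_ jL] ->; exists j.
have hp j k : j <= k -> k < L ->
    ham (f (g (point x s j))) (f (g (point x s k))) = minn (k - j) (L - (k - j)).
  by move=> jk kL; rewrite !fg ham_point.
have uc : uniq c.
  have aux j k : j <= k -> k < L -> g (point x s j) = g (point x s k) -> j = k.
    move=> jk kL E; have := hp j k jk kL; rewrite E ham0; alia.
  apply/mkseq_uniqP => j k; rewrite !inE => jL kL E.
  by case: (leqP j k) => h; [apply: aux | apply/esym/aux; rewrite // ltnW].
have sc : size c = L by rewrite size_mkseq.
have nth_c j : j < L -> nth u0 c j = g (point x s j) by move=> jL; rewrite nth_mkseq.
have nxt j : j < L -> next c (g (point x s j)) = g (point x s (j.+1 %% L)).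
  move=> jL; have jL' : j.+1 %% L < L by rewrite ltn_mod; alia.
  have h := next_index uc (inc j jL).
  have nc : next c (g (point x s j)) \in c by rewrite mem_next inc.
  by rewrite -(nth_index u0 nc) h -(nth_c j jL) index_uniq ?sc // nth_c.
have [sym irr] := sge.
exists c; split=> //; apply: convex_cycle_intro.
- split=> //; first by rewrite sc; apply: ltnW.
  apply: cycle_from_next => // u /cP[j jL ->]; rewrite nxt // ham_edge.
  case: (ltnP j.+1 L) => h; first by rewrite modn_small // hp //; alia.
  have -> : j.+1 = L by alia.
  by rewrite modnn hamC hp //; alia.
- have aux j k : j <= k -> k < L -> e (g (point x s j)) (g (point x s k)) ->
      cycle_rel c (g (point x s j)) (g (point x s k)).
    move=> jk kL; rewrite ham_edge hp // => /eqP h.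
    have jL : j < L by alia.
    rewrite /cycle_rel !inc // !nxt //=; have [h'|h'] : k = j.+1 \/ (j = 0 /\ k.+1 = L) by alia.
      by rewrite -h' modn_small // eqxx.
    by case: h' => -> ->; rewrite modnn eqxx orbT.
  move=> u v /cP[j jL ->] /cP[k kL ->]; case: (leqP j k) => h; first exact: aux.
  rewrite sym => /(aux _ _ (ltnW h) jL).
  by rewrite /cycle_rel andbC -andbA orbC; move=> /and3P[-> -> ->].
move=> u v w /memc ou /memc ov b; apply/memc; apply: conv b => //; exact: vertices_f.
Qed.

End Embedding.

(** * Degrees, the excluded small graphs, and the theorem *)

Lemma cycle_graph_degree L (i : 'I_L) : #|[set j | cycle_graph L i j]| <= 2.
Proof.
rewrite cardE -(size_map val).
have -> : 2 = size [:: i.+1 %% L; (i + L.-1) %% L] by [].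
apply: uniq_leq_size; first by rewrite map_inj_uniq ?enum_uniq //; apply: val_inj.
move=> k /mapP[j]; rewrite mem_enum inE /cycle_graph => /orP[/eqP E|/eqP E] ->; rewrite !inE /=.
  by rewrite E eqxx.
apply/orP; right; rewrite E; have lj := ltn_ord j; apply/eqP => /=.
case: (ltnP j.+1 L) => h.
  by rewrite (modn_small h) (_ : j.+1 + L.-1 = j + L) ?modnDr ?modn_small //; alia.
have EL : j.+1 = L by alia.
by rewrite {1}EL modnn add0n modn_small; alia.
Qed.

Lemma isomorphic_degree (T T' : finType) (e : rel T) (e' : rel T') d :
  isomorphic e e' -> (forall y, #|[set z | e' y z]| <= d) -> forall x, #|[set w | e x w]| <= d.
Proof.
case=> h [bij he] deg x; apply: leq_trans (deg (h x)).
rewrite -(card_imset _ (bij_inj bij)); apply: subset_leq_card.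
by apply/subsetP => y /imsetP[w vw ->]; rewrite inE he; rewrite inE in vw.
Qed.

Lemma regular0_K1 (T : finType) (e : rel T) (x : T) : simple_graph e -> connected e ->
  (forall v, #|[set w | e v w]| = 0) -> isomorphic e (complete_graph 1).
Proof.
move=> [_ irr] conn deg.
have no y z : e y z = false.
  by apply/negP => yz; move/eqP: (deg y); rewrite cards_eq0 => /eqP/setP/(_ z); rewrite !inE yz.
have one : forall y, y = x by apply: (connected_ind conn) => // y z _; rewrite no.
exists (fun _ => ord0); split=> [|y z]; last by rewrite no.
apply: inj_card_bij => [y z _|]; first by rewrite (one y) (one z).
by rewrite card_ord; apply/card_gt0P; exists x.
Qed.

Lemma regular1_K2 (T : finType) (e : rel T) (x : T) : simple_graph e -> connected e ->
  (forall v, #|[set w | e v w]| = 1) -> isomorphic e (complete_graph 2).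
Proof.
move=> [sym irr] conn deg.
have same v w w' : e v w -> e v w' -> w = w'.
  have /eqP/cards1P[z E] := deg v.
  by move/setP: E => E vw vw'; have := E w; have := E w'; rewrite !inE vw vw' => /esym/eqP -> /esym/eqP.
have [y xy] : exists y, e x y by have /eqP/cards1P[y /setP/(_ y)] := deg x; rewrite !inE eqxx; exists y.
have two : forall z, z = x \/ z = y.
  apply: (connected_ind conn); first by left.
  move=> z w [] -> h; [right|left]; first exact: same h xy.
  by apply: same h _; rewrite sym.
have nxy : x != y by apply: contraTneq xy => ->; rewrite irr.
pose h z : 'I_2 := if z == x then ord0 else ord_max.
have hx : h x = ord0 by rewrite /h eqxx.
have hy : h y = ord_max by rewrite /h eq_sym (negbTE nxy).
exists h; split=> [|z w].
  apply: inj_card_bij => [z w|].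
    by case: (two z) => ->; case: (two w) => ->; rewrite ?hx ?hy.
  rewrite card_ord -[2]/(size [:: x; y]).
  have /card_uniqP <- : uniq [:: x; y] by rewrite /= inE nxy.
  exact: max_card.
by case: (two z) => ->; case: (two w) => ->; rewrite ?hx ?hy /complete_graph ?irr ?xy // sym xy.
Qed.

Theorem theorem1p1 (T : finType) (e : rel T) (n : nat) :
  simple_graph e -> 0 < #|T| ->
  partial_cube e -> regular e ->
  ~ isomorphic e (complete_graph 1) -> ~ isomorphic e (complete_graph 2) ->
  4 <= n ->
  ((forall c : seq T, convex_cycle e c -> size c = 2 * n) <->
   isomorphic e (cycle_graph (2 * n))).
Proof.
move=> sg /card_gt0P[x0 _] [m [f [inj edge dist]]] [d deg] nK1 nK2 n4.
have conn := embedding_connected dist; have [sym irr] := sg.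
split=> [allc|iso]; last first.
  (* In a connected graph of maximum degree 2 any cycle is spanning, so its length is the number of
     vertices. *)
  move=> c [cyc _]; have [uc _ _] := cyc.
  have cov := cycle_covers sym conn (isomorphic_degree iso (@cycle_graph_degree _)) cyc.
  by rewrite (cover_size uc cov); have [h [bij _]] := iso; rewrite (bij_eq_card bij) card_ord.
pose V := vertices f; have wgV : well_graded V := vertices_wg edge dist.
(* The closed walk reads its classes twice, so 2n vertices mean n classes; thus [N] is [n.-1]. *)
have ccV x s : ccyc V x s -> size s = n.-1.+1.
  by case/(ccyc_convex_cycle sg inj edge dist) => c [/allc sc E _]; alia.
have N3 : 2 < n.-1 by alia.
have V0 : V != set0 by apply/set0Pn; exists (f x0); apply: vertices_f.
have degV x : x \in V -> d <= #|nbr V x|.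
  by case/imsetP=> v _ ->; rewrite -(deg v); apply: degree_le_nbr.
case: d deg degV => [|[|[|d]]] deg degV.
- by case: nK1; apply: (regular0_K1 x0).
- by case: nK2; apply: (regular1_K2 x0).
- have [x [s cs]] := degree2_ccyc wgV ccV N3 V0 degV.
  have [c [cvx sc _]] := ccyc_convex_cycle sg inj edge dist cs.
  have cov := cycle_covers sym conn (fun v => eq_leq (deg v)) (proj1 cvx).
  by rewrite -(allc c cvx); apply: covering_cycle_isomorphic.
case: (degree3_False wgV ccV N3 V0) => x xV; apply: leq_trans (degV x xV); alia.
Qed.
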